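(* Let $3\le n\le\infty$ and let $\Gamma\le\mathrm{Sym}(n)$. The kaleidoscopic group $\mathcal{K}(\Gamma)$, as a permutation group of $\mathrm{Br}(D_n)$, is oligomorphic if and only if the permutation group $\Gamma$ of $[n]$ is oligomorphic.
   Context: A dendrite is a locally connected continuum (non-empty compact connected metrizable space) containing no simple closed curve. Any two distinct points $x,y$ of a dendrite $X$ are joined by a unique arc $[x,y]$; put $(x,y)=[x,y]\setminus\{x,y\}$. For $x\in X$, $\widehat{x}=\pi_0(X\setminus\{x\})$ is the (at most countable) set of components of $X\setminus\{x\}$; $x$ is a branch point if $|\widehat{x}|\ge 3$, and $\mathrm{Br}(X)$ is the (at most countable) set of branch points. For $3\le n\le\infty$ ($\infty$ meaning countably infinite), the Ważewski dendrite $D_n$ is the dendrite, unique up to homeomorphism, which is not a single point, in which $|\widehat{x}|=n$ for every branch point $x$, and in which $(x,y)$ contains a branch point for all $x\ne y$. Write $[n]=\{m\in\mathbf{N}: m<n\}$ (so $[\infty]=\mathbf{N}\ni 0$) and $\mathrm{Sym}(n)$ for the group of all permutations of $[n]$. A coloring of $D_n$ is a map $c$ from $\widehat{D_n}=\bigsqcup_{x\in\mathrm{Br}(D_n)}\widehat{x}$ to $[n]$ whose restriction $c_x=c|_{\widehat{x}}$ is a bijection $\widehat{x}\to[n]$ for each $x\in \mathrm{Br}(D_n)$; for $y\ne x$, $c_x(y)$ denotes the color of the component of $D_n\setminus\{x\}$ containing $y$. The coloring is kaleidoscopic if for all distinct $x,y\in\mathrm{Br}(D_n)$ and all distinct $i,j\in[n]$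 there is $z\in(x,y)\cap\mathrm{Br}(D_n)$ with $c_z(x)=i$ and $c_z(y)=j$. For $g\in\mathrm{Homeo}(D_n)$ and $x\in\mathrm{Br}(D_n)$ put $\sigma_c(g,x)=c_{g(x)}\circ g\circ c_x^{-1}\in\mathrm{Sym}(n)$, where $g$ is viewed as a bijection $\widehat{x}\to\widehat{g(x)}$. For $\Gamma\le\mathrm{Sym}(n)$ put $\mathcal{K}_c(\Gamma)=\{g\in\mathrm{Homeo}(D_n):\sigma_c(g,x)\in\Gamma\ \text{for all } x\in\mathrm{Br}(D_n)\}$. Kaleidoscopic colorings exist and for any two of them, $c$ and $d$, the groups $\mathcal{K}_c(\Gamma)$ and $\mathcal{K}_d(\Gamma)$ are conjugate in $\mathrm{Homeo}(D_n)$; $\mathcal{K}(\Gamma)$ denotes $\mathcal{K}_c(\Gamma)$ for some (any) kaleidoscopic coloring $c$. It acts faithfully on $\mathrm{Br}(D_n)$. A permutation group $G$ of a set $X$ is oligomorphic if for every $k\in\mathbf{N}$ the diagonal action of $G$ on $X^k$ has finitely many orbits. *)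

(* Defs.v *)
From mathcomp Require Import all_boot all_order all_algebra.
From mathcomp Require Import all_classical all_reals all_analysis.

Set Implicit Arguments.
Unset Strict Implicit.
Unset Printing Implicit Defensive.

Import Order.TTheory GRing.Theory Num.Theory.
Import numFieldNormedType.Exports.

Local Open Scope classical_set_scope.
Local Open Scope card_scope.
Local Open Scope ring_scope.

Definition metrizable (R : realType) (X : topologicalType) : Prop :=
  exists d : X -> X -> R,
    [/\ forall x y, d x y = 0 <-> x = y,
        forall x y, d x y = d y x,
        forall x y z, d x z <= d x y + d y z &
        forall x (U : set X), nbhs x U <->
          exists2 e : R, 0 < e & [set y | d x y < e] `<=` U].

Definition locally_connected (X : topologicalType) : Prop :=
  forall (x : X) (U : set X), nbhs x U ->
    exists V : set X, [/\ open V, connected V, V x & V `<=` U].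

(* [f] and [g] are total functions, but only their restrictions to [A] and [B]
   (with the subspace topologies) matter. *)
Definition homeomorphism_between (S T : topologicalType)
    (A : set S) (B : set T) (f : S -> T) : Prop :=
  {within A, continuous f} /\
  exists g : T -> S,
    [/\ {within B, continuous g}, set_fun A B f, set_fun B A g,
        {in A, cancel f g} & {in B, cancel g f}].

Definition Homeo (X : topologicalType) : set (X -> X) :=
  [set f | continuous f /\
    exists g : X -> X, [/\ continuous g, cancel f g & cancel g f]].

Arguments Homeo : clear implicits.

Definition unit_circle (R : realType) : set (R * R) :=
  [set p | p.1 ^+ 2 + p.2 ^+ 2 = 1].

Arguments unit_circle : clear implicits.

Definition simple_closed_curve (R : realType) (X : topologicalType)
    (S : set X) : Prop :=
  exists f : R * R -> X, homeomorphism_between (unit_circle R) S f.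

Definition continuum (R : realType) (X : topologicalType) : Prop :=
  [/\ [set: X] !=set0, compact [set: X], connected [set: X] & metrizable R X].

Definition dendrite (R : realType) (X : topologicalType) : Prop :=
  [/\ continuum R X, locally_connected X &
      forall S : set X, ~ simple_closed_curve R S].

Definition is_arc (R : realType) (X : topologicalType) (x y : X)
    (A : set X) : Prop :=
  exists f : R -> X,
    [/\ homeomorphism_between (`[0, 1] : set R) A f, f 0 = x & f 1 = y].

(* The arc [x, y]; in a dendrite it exists and is unique when [x <> y].
   The value for [x = y] is irrelevant. *)
Definition arc_between (R : realType) (X : topologicalType) (x y : X) : set X :=
  xget set0 (is_arc R x y).

Definition open_arc (R : realType) (X : topologicalType) (x y : X) : set X :=
  arc_between R x y `\` [set x; y].

Definition component_at (X : topologicalType) (x y : X) : set X :=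
  connected_component (~` [set x]) y.

Definition hat (X : topologicalType) (x : X) : set (set X) :=
  component_at x @` (~` [set x]).

Definition Br (X : topologicalType) : set X := [set x | `I_3 #<= hat x].

Arguments Br : clear implicits.

(* An order [n <= oo] is an [option nat], with [None] standing for infinity. *)
Definition at_least3 (n : option nat) : Prop :=
  if n is Some m then (3 <= m)%N else True.

Definition initial_segment (n : option nat) : set nat :=
  if n is Some m then `I_m else setT.

Definition colors (n : option nat) : Type := set_type (initial_segment n).

Definition wazewski_dendrite (R : realType) (X : topologicalType)
    (n : option nat) : Prop :=
  [/\ dendrite R X,
      exists x y : X, x <> y,
      forall x : X, Br X x -> hat x #= initial_segment n &
      forall x y : X, x <> y -> open_arc R x y `&` Br X !=set0].

(* A coloring takes a branch point [x] and a component of the complement of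
   [x]; its values at other arguments are junk and are never used. *)
Definition is_coloring (X : topologicalType) (n : option nat)
    (c : X -> set X -> colors n) : Prop :=
  forall x, Br X x -> set_bij (hat x) [set: colors n] (c x).

Definition kaleidoscopic (R : realType) (X : topologicalType) (n : option nat)
    (c : X -> set X -> colors n) : Prop :=
  is_coloring c /\
  forall x y, Br X x -> Br X y -> x <> y -> forall i j : colors n, i <> j ->
    exists z, [/\ (open_arc R x y `&` Br X) z,
                  c z (component_at z x) = i & c z (component_at z y) = j].

Definition color_inv (X : topologicalType) (n : option nat)
    (c : X -> set X -> colors n) (x : X) (i : colors n) : set X :=
  xget set0 [set C | hat x C /\ c x C = i].

Definition sigma (X : topologicalType) (n : option nat)
    (c : X -> set X -> colors n) (g : X -> X) (x : X) : colors n -> colors n :=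
  fun i => c (g x) (g @` color_inv c x i).

Definition kaleidoscopic_group (X : topologicalType) (n : option nat)
    (c : X -> set X -> colors n) (Gamma : set (colors n -> colors n)) :
    set (X -> X) :=
  [set g | Homeo X g /\ forall x, Br X x -> Gamma (sigma c g x)].

Arguments kaleidoscopic_group {X n} c Gamma.

Definition permutation_group (T : Type) (G : set (T -> T)) : Prop :=
  [/\ forall s, G s -> bijective s,
      G id,
      forall s t, G s -> G t -> G (s \o t) &
      forall s t, G s -> cancel s t -> G t].

Definition induced_permutations (T : Type) (A : set T) (G : set (T -> T)) :
    set (set_type A -> set_type A) :=
  [set h | exists2 g, G g & forall a, val (h a) = g (val a)].

Arguments induced_permutations {T} A G.

Definition diagonal_orbit (T : Type) (G : set (T -> T)) (k : nat)
    (t : k.-tuple T) : set (k.-tuple T) :=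
  [set map_tuple g t | g in G].

Arguments diagonal_orbit {T} G {k} t.

Definition oligomorphic (T : Type) (G : set (T -> T)) : Prop :=
  forall k : nat, finite_set (range (diagonal_orbit G (k := k))).

(* Main.v *)
Require Import Defs.
From mathcomp Require Import all_boot all_order all_algebra.
From mathcomp Require Import all_classical all_reals all_analysis.
From mathcomp Require Import zify lra.

(** The arc [x, y] enters only through the relation "z separates x from y".
    Any arc with two branch points contains a branch point separating its ends,
    so branch points separate the points of X, and X becomes a tree-like
    structure in which three points none of which separates the other two have
    a center; the center exists by compactness.

    On branch points the coloring [k x y], the color at x of the component
    containing y, encodes separation: z separates x from y iff
    [k z x <> k z y].  A finite partial map [x_i |-> y_i] together with elements
    [g_i] of Gamma such that [k y_i y_j = g_i (k x_i x_j)], with domain and range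
    closed under centers, extends to any further branch point because the
    coloring is kaleidoscopic.  Back-and-forth over the countable set of branch
    points, followed by extension to X along the subbase of components of
    complements of branch points, produces an element of K(Gamma).

    Hence the K(Gamma)-orbit of a tuple is determined by the equalities between
    the entries of its center-closed hull and by the Gamma-orbits of the color
    tuples at these entries, which bounds the number of orbits when Gamma is
    oligomorphic.  Conversely, tuples of colors are realised at a fixed branch
    point by tuples of branch points, and equivalent tuples of branch points
    have Gamma-equivalent colors. *)

Set Implicit Arguments.
Unset Strict Implicit.
Unset Printing Implicit Defensive.

Import Order.TTheory GRing.Theory Num.Theory.
Import numFieldNormedType.Exports.

Local Open Scope classical_set_scope.

(** * Colored pretrees and back-and-forth *)

Lemma finite_minimal (T : choiceType) (A : set T) (lt : T -> T -> Prop) :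
  finite_set A -> A !=set0 -> (forall a, ~ lt a a) ->
  (forall a b d, lt a b -> lt b d -> lt a d) ->
  exists2 m, A m & forall a, A a -> ~ lt a m.
Proof.
move=> /finite_seqP[s ->] + irr tr.
elim: s => [|a s IHs]; first by move=> [].
move=> _; have [s0|/set0P/IHs[m ms mmin]] := eqVneq [set` s] set0.
  exists a; first by rewrite /= mem_head.
  move=> b /=; rewrite inE => /orP[/eqP-> //|bs].
  by have : [set` s] b by []; rewrite s0.
have [am|nam] := pselect (lt a m).
  exists a; first by rewrite /= mem_head.
  move=> b /=; rewrite inE => /orP[/eqP-> //|bs ba].
  by apply: (mmin b bs); apply: tr ba am.
exists m; first by rewrite /= inE ms orbT.
by move=> b /=; rewrite inE => /orP[/eqP-> //|bs]; exact: mmin.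
Qed.

(* [tca] is the inverse of [act], stored to make the exchange of source and
   target a mere permutation of the fields. *)
Record local_iso (T C : Type) :=
  LocalIso { src : T; tgt : T; act : C -> C; tca : C -> C }.

Definition swap_iso (T C : Type) (e : local_iso T C) : local_iso T C :=
  LocalIso (tgt e) (src e) (tca e) (act e).

Section Separation.
Variables (T : Type) (C : Type) (k : T -> T -> C).

(** Serves two kinds of directions at [z]: components of the complement of [z], and colors at a
    branch point. *)
Definition separates (z x y : T) := [/\ x <> z, y <> z & k z x <> k z y].

Definition median_closed (F : set T) := forall p q r w, F p -> F q -> F r ->
  separates w p q -> separates w q r -> separates w p r -> F w.

(** The single betweenness axiom; transitivity and the other rules of this section follow from
    it. *)
Definition stepwise := forall w x f, separates w x f -> k f x = k f w.

Hypothesis kS : stepwise.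

Lemma separatesC z x y : separates z x y -> separates z y x.
Proof. by move=> [? ? /nesym]. Qed.

Lemma separates_irr z x : ~ separates z x x.
Proof. by move=> []. Qed.

Lemma separates_neq z x y : separates z x y -> x <> y.
Proof. by move=> [? ? ne] xy; apply: ne; rewrite xy. Qed.

Lemma color_nonseparated z x y :
  x <> z -> y <> z -> ~ separates z x y -> k z x = k z y.
Proof. by move=> xz yz n; apply: contrapT => ne; apply: n. Qed.

Lemma separates_trans x a b d :
  separates a x b -> separates b x d -> separates a x d.
Proof.
move=> ab bd; have [xa ba n1] := ab; have [xb db n2] := bd.
have e : k b x = k b a := kS ab.
have da : d <> a by move=> da; apply: n2; rewrite da.
have bad : separates b a d by split=> //; [exact/nesym|rewrite -e].
have e2 := kS (separatesC bad).
by split=> //; rewrite e2.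
Qed.

(** The point [w] separates [f] from [p] or from [q], so [f] sees [w] in the direction of one of
    them, and these two directions agree at [f]. *)
Lemma color_between w p q f :
  separates w p q -> f <> w -> f <> p -> f <> q -> ~ separates f p q ->
  k f w = k f p.
Proof.
move=> wpq fw fp fq npq; have [pw qw npwq] := wpq.
have [fpw|e] := pselect (separates w p f); first by rewrite (kS fpw).
have wq : separates w q f.
  by split=> // qf; apply: e; split=> //; rewrite -qf.
by rewrite -(kS wq) (color_nonseparated _ _ npq) //; exact/nesym.
Qed.

Lemma color_side z p q f : separates z p q -> separates p f q -> k z f = k z p.
Proof.
move=> zpq [fp qp ne]; have [pz qz _] := zpq.
apply: kS; split=> //; first exact/nesym.
by rewrite -(kS (separatesC zpq)).
Qed.

End Separation.

Section ColoredPretree.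
Variables (T : choiceType) (C : Type) (k : T -> T -> C).
Local Notation separates := (separates k).
Local Notation median_closed := (median_closed k).

(** The properties of branch points from which automorphisms are built; [branch_colored_pretree]
    establishes them. In [color_rich] the distinct colors force [z] to separate [x] from [y]. *)
Record colored_pretree : Prop := ColoredPretree {
  color_step : stepwise k;
  color_rich : forall x y, x <> y -> forall i j, i <> j ->
    exists2 z, z <> x /\ z <> y & k z x = i /\ k z y = j;
  color_full : forall x i, exists2 y, y <> x & k x y = i;
  color_alt : forall i : C, exists j, i <> j;
  center_ex : forall x y z, x <> y -> y <> z -> x <> z ->
    ~ separates x y z -> ~ separates y x z -> ~ separates z x y ->
    exists w, [/\ separates w x y, separates w y z & separates w x z] }.

Hypothesis kT : colored_pretree.
Let kS := color_step kT.

(** A center [v] other than [w] sees [w] in the direction of [p] or of [q]. Replacing [w] by that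
    point exhibits [v] as a center of three points of [F]. *)
Lemma median_closed_insert F p q w :
  median_closed F -> F p -> F q -> separates w p q -> median_closed (w |` F).
Proof.
move=> Fc Fp Fq wpq a b d v Fa Fb Fd vab vbd vad.
have [-> |vw] := pselect (v = w); first by left.
right; apply: contrapT => nFv.
have rep x : (w |` F) x -> exists2 x', F x' & x' <> v /\ k v x' = k v x.
  move=> [->|Fx]; last by exists x => //; split=> // xv; apply: nFv; rewrite -xv.
  have [vp|vp] := pselect (separates w p v).
    exists p => //; split; last exact: kS vp.
    by move=> e; apply: nFv; rewrite -e.
  exists q => //; split; first by move=> e; apply: nFv; rewrite -e.
  apply: kS; have [pw qw ne] := wpq.
  by split=> // qv; apply: vp; split=> //; rewrite -qv.
have [a' Fa' [a'v ea]] := rep _ Fa; have [b' Fb' [b'v eb]] := rep _ Fb.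
have [d' Fd' [d'v ed]] := rep _ Fd.
case: vab vbd vad => [_ _ n1] [_ _ n2] [_ _ n3].
by apply/nFv/(Fc a' b' d'); rewrite // /separates ?ea ?eb ?ed.
Qed.

(** A point [v] on the side of [x] at [p] sees all of [F] in one direction, which leaves at most two
    directions for a triple. Any other [v] sees [x] in the direction of [p], so [p] replaces [x]. *)
Lemma median_closed_attach F p x : median_closed F -> F p -> x <> p ->
  (forall f, F f -> f <> p -> k p f <> k p x) -> median_closed (x |` F).
Proof.
move=> Fc Fp xp far a b d v Fa Fb Fd vab vbd vad.
have [-> |vx] := pselect (v = x); first by left.
right; apply: contrapT => nFv.
have vp : v <> p by move=> e; apply: nFv; rewrite e.
have rep y : (x |` F) y -> y = x \/ (F y /\ y <> v).
  move=> [->|Fy]; [by left|right]; split=> // e; apply: nFv; rewrite -e; exact: Fy.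
case: (vab) (vbd) (vad) => [av bv n1] [_ dv n2] [_ _ n3].
have [pvx|pvx] := pselect (k p v = k p x).
  have all_p f : F f -> k v f = k v p.
    move=> Ff; have [-> //|fp] := pselect (f = p).
    by apply: kS; split=> //; rewrite pvx; exact: far.
  have [ax|[/all_p Fa' _]] := rep _ Fa; have [bx|[/all_p Fb' _]] := rep _ Fb;
    have [dx|[/all_p Fd' _]] := rep _ Fd; move: n1 n2 n3; rewrite ?ax ?bx ?dx;
    by rewrite ?Fa' ?Fb' ?Fd'.
have vxp : k v x = k v p by apply: kS; split=> //; exact/nesym.
have rep' y : (x |` F) y -> exists2 y', F y' & y' <> v /\ k v y' = k v y.
  move=> /rep[->|[Fy yv]]; last by exists y.
  by exists p => //; split=> //; exact/nesym.
have [a' Fa' [a'v ea]] := rep' _ Fa; have [b' Fb' [b'v eb]] := rep' _ Fb.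
have [d' Fd' [d'v ed]] := rep' _ Fd.
by apply/nFv/(Fc a' b' d'); rewrite // /separates ?ea ?eb ?ed.
Qed.

(* [w] is the gate of [x] in the subtree spanned by [F]. *)
Lemma gate F x : finite_set F -> F !=set0 -> median_closed F ->
  exists w, (F w \/ exists p q, [/\ F p, F q, separates w p q &
                                   forall f, F f -> ~ separates f p q]) /\
    (x = w \/ (x <> w /\ forall f, (w |` F) f -> f <> w -> k w f <> k w x)).
Proof.
move=> Ff F0 Fc; have [Fx|nFx] := pselect (F x).
  by exists x; split; left.
have neF f : F f -> f <> x by move=> ? e; apply: nFx; rewrite -e.
(* A point of [F] closest to [x]: no point of [F] separates [x] from [p]. *)
have [p Fp pmin] := @finite_minimal _ F (fun a b => separates a x b) Ff F0
  (fun a => fun h => let: And3 _ e _ := h in e erefl)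
  (separates_trans kS (x := x)).
have [[q0 Fq0]|nq] := pselect (F `&` [set q | q <> p /\ k p q = k p x] !=set0);
    last first.
  exists p; split; first by left.
  right; split=> [e|f]; first by apply: (neF _ Fp).
  move=> [-> //|Ff'] fp e; apply: nq; exists f; split=> //.
(* Among the points of [F] in the direction of [x] at [p], one closest to [p]. Then [p] and [q] span
   an edge, and the gate is [x] itself or the center of [p], [q], [x]. *)
have [q [Fq [qp qpx]] qmin] := @finite_minimal _
  (F `&` [set q | q <> p /\ k p q = k p x]) (fun a b => separates a p b)
  (finite_setIl _ Ff) (ex_intro _ q0 Fq0)
  (fun a => fun h => let: And3 _ e _ := h in e erefl)
  (separates_trans kS (x := p)).
have edge f : F f -> ~ separates f p q.
  move=> Ff' fpq; have [pf qf ne] := fpq.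
  apply: (qmin f) => //; split=> //; split; first exact/nesym.
  by rewrite -qpx; apply/esym/kS/separatesC.
have npqx : ~ separates p q x by move=> [_ _]; rewrite qpx.
have nqpx : ~ separates q p x by move=> h; apply: (pmin q Fq); exact: separatesC.
have [xpq|nxpq] := pselect (separates x p q).
  by exists x; split; [right; exists p, q|left].
have [w [wpq wqx wpx]] := center_ex kT (nesym qp) (neF _ Fq) (neF _ Fp)
  npqx nqpx nxpq.
have [pw qw npq] := wpq; have [_ xw nqx] := wqx; have [_ _ npx] := wpx.
exists w; split; first by right; exists p, q.
right; split=> // f [-> //|Ff'] fw e.
(* Otherwise [w] would be the center of [p], [q], [f], hence a point of [F] inside the edge. *)
apply: (edge w) => //; apply: (Fc p q f) => //; split=> //; by rewrite e.
Qed.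

(** * Extending finite partial isomorphisms *)

Variable Gamma : set (C -> C).
Hypotheses (Gamma_id : Gamma id).

Let dom (L : set (local_iso T C)) := @src T C @` L.
Let ran (L : set (local_iso T C)) := @tgt T C @` L.

Record partial_iso (L : set (local_iso T C)) : Prop := PartialIso {
  piso_fin : finite_set L;
  piso_act : forall e, L e ->
    [/\ Gamma (act e), Gamma (tca e), cancel (act e) (tca e) &
        cancel (tca e) (act e)];
  piso_src : forall e e', L e -> L e' -> src e = src e' -> e = e';
  piso_tgt : forall e e', L e -> L e' -> tgt e = tgt e' -> e = e';
  piso_color : forall e e', L e -> L e' -> src e <> src e' ->
    k (tgt e) (tgt e') = act e (k (src e) (src e'));
  piso_dom : median_closed (dom L);
  piso_ran : median_closed (ran L) }.

Lemma partial_iso_swap L : partial_iso L -> partial_iso (@swap_iso T C @` L).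
Proof.
move=> [fL aL sL tL cL dL rL].
have dE : dom (@swap_iso T C @` L) = ran L.
  by rewrite /dom /ran image_comp; exact: eq_imagel.
have rE : ran (@swap_iso T C @` L) = dom L.
  by rewrite /dom /ran image_comp; exact: eq_imagel.
split; rewrite ?dE ?rE //.
- exact: finite_image.
- by move=> _ [e /aL[? ? ? ?] <-].
- by move=> _ _ [e Le <-] [e' Le' <-] /= /(tL _ _ Le Le')->.
- by move=> _ _ [e Le <-] [e' Le' <-] /= /(sL _ _ Le Le')->.
- move=> _ _ [e Le <-] [e' Le' <-] /= ne.
  have [_ _ c1 _] := aL _ Le; rewrite (cL _ _ Le Le') ?c1 //.
  by move=> /(sL _ _ Le Le') e0; apply: ne; rewrite e0.
Qed.

Lemma partial_iso_add L e : partial_iso L ->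
  [/\ Gamma (act e), Gamma (tca e), cancel (act e) (tca e) &
      cancel (tca e) (act e)] ->
  (forall e', L e' -> src e <> src e' /\ tgt e <> tgt e') ->
  (forall e', L e' -> k (tgt e) (tgt e') = act e (k (src e) (src e'))) ->
  (forall e', L e' -> k (tgt e') (tgt e) = act e' (k (src e') (src e))) ->
  median_closed (src e |` dom L) -> median_closed (tgt e |` ran L) ->
  partial_iso (e |` L).
Proof.
move=> [fL aL sL tL cL dL rL] ae ne c1 c2 de re; split.
- by rewrite finite_setU; split=> //; exact: finite_set1.
- by move=> f [->|] //; exact: aL.
- move=> f f' [->|Le] [->|Le'] //; last exact: sL.
  + by have [n1 _] := ne _ Le'.
  + by have [n1 _] := ne _ Le => /esym.
- move=> f f' [->|Le] [->|Le'] //; last exact: tL.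
  + by have [_ n1] := ne _ Le'.
  + by have [_ n1] := ne _ Le => /esym.
- by move=> f f' [->|Le] [->|Le'] // n; [exact: c1|exact: c2|exact: cL].
- by rewrite /dom image_setU image_set1.
- by rewrite /ran image_setU image_set1.
Qed.

Lemma sep_piso L e e' e'' : partial_iso L -> L e -> L e' -> L e'' ->
  separates (src e) (src e') (src e'') -> separates (tgt e) (tgt e') (tgt e'').
Proof.
move=> pL Le Le' Le'' [n1 n2 n3]; have [_ _ c1 _] := piso_act pL Le; split.
- by move=> /(piso_tgt pL Le' Le) e0; apply: n1; rewrite e0.
- by move=> /(piso_tgt pL Le'' Le) e0; apply: n2; rewrite e0.
- rewrite !(piso_color pL) //; try exact/nesym.
  by move=> /(can_inj c1).
Qed.

Lemma sep_piso_inv L e e' e'' : partial_iso L -> L e -> L e' -> L e'' ->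
  separates (tgt e) (tgt e') (tgt e'') -> separates (src e) (src e') (src e'').
Proof.
move=> pL Le Le' Le''.
by apply: (sep_piso (e := swap_iso e) (e' := swap_iso e') (e'' := swap_iso e'')
  (partial_iso_swap pL)); apply: imageP.
Qed.

(* Expresses the side of [w] on which [f] lies by a separation between points of
   [F], which a partial isomorphism transports. *)
Lemma edge_side F p q w f : median_closed F -> F p -> F q -> F f ->
  (forall f, F f -> ~ separates f p q) -> separates w p q ->
  f <> p -> f <> w -> k w f = k w p -> separates p f q.
Proof.
move=> Fc Fp Fq Ff' edge wpq fp fw e; have [pw qw npq] := wpq.
have fq : f <> q by move=> fq; apply: npq; rewrite -fq.
apply: contrapT => nfq.
have qpf : ~ separates q p f.
  have wqp : separates w f q by split=> //; rewrite e.
  by move=> [_ _]; rewrite (kS wpq) (kS wqp).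
have [m [mfq mqp mfp]] := center_ex kT fq (nesym (separates_neq wpq)) fp
  (edge f Ff' \o @separatesC _ _ _ _ _ _) (qpf \o @separatesC _ _ _ _ _ _) nfq.
apply: (edge m); last exact: separatesC.
by apply: (Fc f q p).
Qed.


(** Richness of the coloring gives [z] between the targets showing them the same two colors that [w]
    shows the sources, so the identity can be the local action at [w]. *)
Lemma extend_edge L e1 e2 w : partial_iso L -> L e1 -> L e2 ->
  separates w (src e1) (src e2) ->
  (forall f, dom L f -> ~ separates f (src e1) (src e2)) ->
  exists2 e, src e = w & partial_iso (e |` L).
Proof.
move=> pL L1 L2 wpq edge; have [pw qw npq] := wpq.
have ne : src e1 <> src e2 := separates_neq wpq.
have ne' : tgt e1 <> tgt e2 by move=> /(piso_tgt pL L1 L2) e; apply: ne; rewrite e.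
have [z [zp zq] [kzp kzq]] := color_rich kT ne' npq.
have zpq : separates z (tgt e1) (tgt e2).
  by split; [exact/nesym|exact/nesym|rewrite kzp kzq].
have edge' f : ran L f -> ~ separates f (tgt e1) (tgt e2).
  move=> [e Le <-] /(sep_piso_inv pL Le L1 L2); apply: edge; exact: imageP.
have fw f : L f -> src f <> w.
  by move=> Lf e; apply: (edge (src f)); [exact: imageP|rewrite e].
have fz f : L f -> tgt f <> z.
  by move=> Lf e; apply: (edge' (tgt f)); [exact: imageP|rewrite e].
have dL := imageP (@src T C); have rL := imageP (@tgt T C).
exists (LocalIso w z id id) => //.
apply: partial_iso_add => //=.
- by move=> e Le; split; apply/nesym; [exact: fw|exact: fz].
- move=> e Le.
  have [->|e_1] := pselect (e = e1); first by rewrite kzp.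
  have [->|e_2] := pselect (e = e2); first by rewrite kzq.
  have s1 : src e <> src e1 by move=> /(piso_src pL Le L1).
  have s2 : src e <> src e2 by move=> /(piso_src pL Le L2).
  (* A source on the side of [src e1] lies beyond [src e1]; this separation is transported to the
     targets, where [color_side] recovers the color at [z]. *)
  have [ep|np] := pselect (k w (src e) = k w (src e1)).
    rewrite ep -kzp; apply: (color_side kS zpq); apply: (sep_piso pL) => //.
    exact: (edge_side (piso_dom pL) (dL _ _ L1) (dL _ _ L2) (dL _ _ Le)
      edge wpq s1 (fw _ Le) ep).
  have [eq|nq] := pselect (k w (src e) = k w (src e2)).
    rewrite eq -kzq; apply: (color_side kS (separatesC zpq)).
    apply: (sep_piso pL) => //.
    by apply: (edge_side (piso_dom pL) (dL _ _ L2) (dL _ _ L1) (dL _ _ Le)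
      _ (separatesC wpq) s2 (fw _ Le) eq) => f Lf h; apply: (edge f Lf); exact: separatesC.
  (* A third direction at [w] would make [w] a center of three sources, hence a source inside the
     edge. *)
  exfalso; apply: (edge w) => //.
  apply: (piso_dom pL (dL _ _ L1) (dL _ _ L2) (dL _ _ Le)) => //.
    by split=> //; [exact: fw|exact/nesym].
  by split=> //; [exact: fw|exact/nesym].
- move=> e Le.
  have [->|e_1] := pselect (e = e1).
    rewrite -(kS (separatesC wpq)) -(kS (separatesC zpq)).
    exact: (piso_color pL).
  have [->|e_2] := pselect (e = e2).
    rewrite -(kS wpq) -(kS zpq).
    by apply: (piso_color pL) => //; exact/nesym.
  have s1 : src e <> src e1 by move=> /(piso_src pL Le L1).
  have s2 : src e <> src e2 by move=> /(piso_src pL Le L2).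
  have t1 : tgt e <> tgt e1 by move=> /(piso_tgt pL Le L1).
  have t2 : tgt e <> tgt e2 by move=> /(piso_tgt pL Le L2).
  rewrite (color_between kS wpq (fw _ Le) s1 s2 (edge _ (dL _ _ Le))).
  rewrite (color_between kS zpq (fz _ Le) t1 t2 (edge' _ (rL _ _ Le))).
  exact: (piso_color pL).
- exact: (median_closed_insert (piso_dom pL) (dL _ _ L1) (dL _ _ L2)).
- exact: (median_closed_insert (piso_ran pL) (rL _ _ L1) (rL _ _ L2)).
Qed.

(** Since [x] hangs on [src e] in a direction free of sources, only two colors have to be right:
    that of the new target at [tgt e], and that of [tgt e] at the new target. *)
Lemma extend_leaf L e x : partial_iso L -> L e -> x <> src e ->
  (forall f, dom L f -> f <> src e -> k (src e) f <> k (src e) x) ->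
  exists2 e', src e' = x & partial_iso (e' |` L).
Proof.
move=> pL Le xp far; have [_ _ ac _] := piso_act pL Le.
have [y yp kpy] := color_full kT (tgt e) (act e (k (src e) x)).
(* The point [y] lies in the right direction but may show [tgt e] a wrong color. A point [z] between
   them shows the right one; [j] is any other color. *)
have [j nj] := color_alt kT (k x (src e)).
have [z [zp zy] [kzp kzy]] := color_rich kT (nesym yp) nj.
have kpz : k (tgt e) z = act e (k (src e) x).
  rewrite -kpy; apply/esym/kS.
  by split; [exact/nesym|exact/nesym|rewrite kzp kzy; exact/nesym].
have srcN f : L f -> f <> e -> src f <> src e by move=> Lf fe /(piso_src pL Lf Le).
have tgtN f : L f -> f <> e -> tgt f <> tgt e by move=> Lf fe /(piso_tgt pL Lf Le).
have far1 f : L f -> f <> e -> k (src e) (src f) <> k (src e) x.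
  by move=> Lf fe; apply: far; [exact: imageP|exact: srcN].
have far2 f : L f -> f <> e -> k (tgt e) (tgt f) <> k (tgt e) z.
  move=> Lf fe; rewrite kpz (piso_color pL Le Lf); last exact/nesym/srcN.
  by move=> /(can_inj ac); exact: far1.
have fx f : L f -> src f <> x.
  move=> Lf; have [->|fe] := pselect (f = e); first exact/nesym.
  by move=> e0; apply: (far1 _ Lf fe); rewrite e0.
have fz f : L f -> tgt f <> z.
  move=> Lf; have [->|fe] := pselect (f = e); first exact/nesym.
  by move=> e0; apply: (far2 _ Lf fe); rewrite e0.
have sep1 f : L f -> f <> e -> separates (src e) (src f) x.
  by move=> Lf fe; split=> //; [exact: srcN|exact: far1].
have sep2 f : L f -> f <> e -> separates (tgt e) (tgt f) z.
  by move=> Lf fe; split=> //; [exact: tgtN|exact: far2].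
exists (LocalIso x z id id) => //.
apply: partial_iso_add => //=.
- by move=> f Lf; split; apply/nesym; [exact: fx|exact: fz].
- move=> f Lf; have [-> //|fe] := pselect (f = e).
  by rewrite (kS (sep1 _ Lf fe)) (kS (sep2 _ Lf fe)).
- move=> f Lf; have [-> //|fe] := pselect (f = e).
  rewrite (kS (separatesC (sep1 _ Lf fe))).
  rewrite (kS (separatesC (sep2 _ Lf fe))).
  by apply: (piso_color pL) => //; exact: srcN.
- apply: (median_closed_attach (p := src e) (piso_dom pL)) => //; exact: imageP.
- apply: (median_closed_attach (p := tgt e) (piso_ran pL)) => //.
  + exact: imageP.
  + move=> _ [f Lf <-] fe; apply: far2 => // fe0; apply: fe; rewrite fe0; by [].
Qed.

Lemma median_closed_set1 x : median_closed [set x].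
Proof. by move=> a b d v -> -> -> h; have := separates_irr h. Qed.

Lemma extend_dom L x : partial_iso L ->
  exists L', [/\ partial_iso L', L `<=` L' & dom L' x].
Proof.
move=> pL; have [L0|/set0P[e0 Le0]] := eqVneq L set0.
  exists [set LocalIso x x id id]; rewrite L0; split=> //; last first.
    by exists (LocalIso x x id id).
  split; first exact: finite_set1.
  - by move=> _ ->.
  - by move=> _ _ -> ->.
  - by move=> _ _ -> ->.
  - by move=> _ _ -> ->.
  - by rewrite /dom image_set1; exact: median_closed_set1.
  - by rewrite /ran image_set1; exact: median_closed_set1.
have d0 : dom L !=set0 by exists (src e0); exact: imageP.
(* First the gate of [x] is added on its edge, then [x] is hung on it as a leaf. *)
have [w [wF xw]] := gate x (finite_image (@src T C) (piso_fin pL)) d0 (piso_dom pL).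
have [L1 [pL1 LL1 L1w domL1]] : exists L1, [/\ partial_iso L1, L `<=` L1,
    dom L1 w & dom L1 `<=` w |` dom L].
  case: wF => [Lw|[_ [_ [[e1 Le1 <-] [e2 Le2 <-] wpq edge]]]].
    by exists L; split=> // f ?; right.
  have [e ew pL1] := extend_edge pL Le1 Le2 wpq edge.
  exists (e |` L); split=> //.
  - by exists e => //; left.
  - by rewrite /dom image_setU image_set1 ew.
case: xw => [->|[nxw far]]; first by exists L1.
case: L1w => e Le ew; rewrite -{}ew in nxw far domL1.
have [e' e'x pL2] := extend_leaf pL1 Le nxw (fun f h => far f (domL1 f h)).
exists (e' |` L1); split=> //; first by move=> f /LL1 ?; right.
by exists e' => //; left.
Qed.

Lemma extend_both L x : partial_iso L ->
  exists L', [/\ partial_iso L', L `<=` L', dom L' x & ran L' x].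
Proof.
move=> pL; have [L1 [pL1 LL1 L1x]] := extend_dom x pL.
have [L2 [pL2 L12 [e Le ex]]] := extend_dom x (partial_iso_swap pL1).
exists (@swap_iso T C @` L2); split; first exact: partial_iso_swap.
- move=> f /LL1 L1f; exists (swap_iso f); last by case: f L1f.
  by apply: L12; exact: imageP.
- case: L1x => f L1f fx; exists f => //; exists (swap_iso f); last by case: f L1f fx.
  by apply: L12; exact: imageP.
- by exists (swap_iso e) => //; exact: imageP.
Qed.

(** Here [gamma x] is the local action of [phi] at [x]; the inverses [psi] and [delta x] are kept as
    data. *)
Record colored_auto (phi psi : T -> T) (gamma delta : T -> C -> C) : Prop :=
  ColoredAuto {
    cauto_K : cancel phi psi;
    cauto_VK : cancel psi phi;
    cauto_act : forall x, [/\ Gamma (gamma x), Gamma (delta x),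
      cancel (gamma x) (delta x) & cancel (delta x) (gamma x)];
    cauto_color : forall x y, x <> y -> k (phi x) (phi y) = gamma x (k x y) }.

Lemma back_and_forth L0 : countable [set: T] -> partial_iso L0 ->
  exists phi psi gamma delta, colored_auto phi psi gamma delta /\
    forall e, L0 e -> phi (src e) = tgt e.
Proof.
move=> /countable_injP[enc encI] pL0.
(* At stage [n] the point with code [n], if any, enters domain and range. Stating the guarantee as
   an implication makes the step total, as [choice] requires. *)
have step nL : exists L', partial_iso nL.2 -> [/\ partial_iso L', nL.2 `<=` L' &
    forall x, enc x = nL.1 -> dom L' x /\ ran L' x].
  have [pL|npL] := pselect (partial_iso nL.2); last by exists set0.
  have [[x ex]|nx] := pselect (exists x, enc x = nL.1); last first.
    by exists nL.2 => _; split=> // x ex; exfalso; apply: nx; exists x.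
  have [L' [pL' LL' dx rx]] := extend_both x pL.
  exists L' => _; split=> // y; rewrite -ex => /encI -> //; by rewrite inE.
have [next nextP] := choice step.
pose Ls := fix Ls n := if n is m.+1 then next (m, Ls m) else L0.
have pLs n : partial_iso (Ls n).
  by elim: n => //= n IHn; have [] := nextP (n, Ls n) IHn.
have Lsub m n : (m <= n)%N -> Ls m `<=` Ls n.
  elim: n => [|n IHn]; first by rewrite leqn0 => /eqP->.
  rewrite leq_eqVlt => /orP[/eqP->//|/IHn mn] e /mn.
  by have [_ /(_ e)] := nextP (n, Ls n) (pLs n).
pose U := \bigcup_n Ls n.
have common e e' : U e -> U e' -> exists n, Ls n e /\ Ls n e'.
  move=> [m _ em] [n _ en]; exists (maxn m n).
  by split; [exact: Lsub (leq_maxl _ _) _ em|exact: Lsub (leq_maxr _ _) _ en].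
have hdom x : exists e, U e /\ src e = x.
  have [_ _ /(_ x erefl)[[e Le ex] _]] := nextP (enc x, Ls (enc x)) (pLs _).
  by exists e; split=> //; exists (enc x).+1.
have hran x : exists e, U e /\ tgt e = x.
  have [_ _ /(_ x erefl)[_ [e Le ex]]] := nextP (enc x, Ls (enc x)) (pLs _).
  by exists e; split=> //; exists (enc x).+1.
have [E EP] := choice hdom; have [E' EP'] := choice hran.
have src_inj e e' : U e -> U e' -> src e = src e' -> e = e'.
  by move=> Ue Ue'; have [n [h h']] := common _ _ Ue Ue'; exact: (piso_src (pLs n)).
have tgt_inj e e' : U e -> U e' -> tgt e = tgt e' -> e = e'.
  by move=> Ue Ue'; have [n [h h']] := common _ _ Ue Ue'; exact: (piso_tgt (pLs n)).
exists (fun x => tgt (E x)), (fun x => src (E' x)), (fun x => act (E x)),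
  (fun x => tca (E x)); split; first split.
- move=> x; have [Ux sx] := EP x; have [Ux' sx'] := EP' (tgt (E x)).
  by rewrite (tgt_inj _ _ Ux' Ux).
- move=> x; have [Ux sx] := EP' x; have [Ux' sx'] := EP (src (E' x)).
  by rewrite (src_inj _ _ Ux' Ux).
- by move=> x; have [[n _ h] _] := EP x; exact: (piso_act (pLs n)).
- move=> x y xy; have [Ux sx] := EP x; have [Uy sy] := EP y.
  have [n [hx hy]] := common _ _ Ux Uy.
  by rewrite (piso_color (pLs n) hx hy) sx sy.
- move=> e L0e; have [Ux sx] := EP (src e).
  by rewrite (src_inj _ _ Ux _ sx) //; exists 0%N.
Qed.

(** * Center-closed hulls of fixed length *)

Fixpoint odds (s : seq T) : seq T :=
  if s is _ :: y :: s' then y :: odds s' else [::].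

(** Each point is added together with its gate, placed just before it, even if the gate repeats a
    known point. The length then depends only on that of [l], and [l] is read off by position. *)
Lemma median_hull (l : seq T) : exists s,
  [/\ size s = (size l).*2, odds s = l & median_closed [set` s]].
Proof.
elim: l => [|x l [s [ss os cs]]].
  by exists [::]; split=> // p q r w.
have consE (y : T) u : [set` y :: u] = y |` [set` u].
  apply/seteqP; split=> z /=; rewrite inE; first by case/orP => [/eqP->|?]; [left|right].
  by move=> [->|zu]; apply/orP; [left|right].
suff [w cw] : exists w, median_closed [set` w :: x :: s].
  by exists [:: w, x & s]; split => //=; rewrite ?ss ?os.
have [s0|/set0P s0] := eqVneq [set` s] set0.
  by exists x; rewrite !consE s0 setU0 setUid; exact: median_closed_set1.
have [w [wF xw]] := gate x (finite_seq s) s0 cs.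
exists w; rewrite !consE setUCA.
have cws : median_closed (w |` [set` s]).
  case: wF => [ws|[p [q [ps qs wpq _]]]].
    by rewrite setUC (_ : _ `|` _ = [set` s]) //; apply/setUidPl => _ ->.
  exact: (median_closed_insert cs ps qs).
case: xw => [->|[nxw far]]; first by rewrite setUA setUid.
by apply: (median_closed_attach (p := w) cws) => //; left.
Qed.

End ColoredPretree.

(** * Counting orbits *)

(** Turns orbits into values of a finite type. The successor in ['I_N.+1] keeps the codomain
    inhabited when [A] is empty; codes outside [A] are junk. *)
Lemma finite_code (U : Type) (A : set U) : finite_set A ->
  exists (N : nat) (f : U -> 'I_N.+1), forall a b, A a -> A b -> f a = f b -> a = b.
Proof.
move=> /finite_setP[N /card_set_bijP[f [fun_f inj_f _]]].
exists N, (inord \o f) => a b Aa Ab /= /(congr1 val) /=.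
have fA x : A x -> (f x < N.+1)%N by move=> /fun_f /= /ltnW.
rewrite !inordK ?fA //; by apply: inj_f; rewrite inE.
Qed.

Lemma finite_range_invariant (A U : Type) (I : finType) (D : A -> set U)
    (inv : A -> I) :
  (forall a b, inv a = inv b -> D a = D b) -> finite_set (range D).
Proof.
(* All sets [D a] over one fiber of [inv] coincide, so their union is that common set and no
   representative has to be chosen. *)
move=> Dinv; pose h i := \bigcup_(a in [set a | inv a = i]) D a.
apply: (sub_finite_set (B := range h)); last first.
  by apply: finite_image; exact: finite_finset.
move=> _ [a _ <-]; exists (inv a) => //; apply/seteqP; split=> u.
  by move=> [b /Dinv <-].
by move=> Du; exists a.
Qed.

Section PermutationGroup.
Variables (C : Type) (Gamma : set (C -> C)).
Hypothesis hGamma : permutation_group Gamma.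

Lemma diagonal_orbit_eq k (t t' : k.-tuple C) :
  diagonal_orbit Gamma t = diagonal_orbit Gamma t' ->
  exists2 g, Gamma g & map_tuple g t = t'.
Proof.
move=> tt'; case: hGamma => _ Gid _ _.
have : diagonal_orbit Gamma t' t'.
  by exists id => //; apply/val_inj; rewrite /= map_id.
rewrite -tt' => -[g Gg gt]; exists g => //.
Qed.

Lemma permutation_group_inv g : Gamma g ->
  exists g', [/\ Gamma g', cancel g g' & cancel g' g].
Proof.
case: hGamma => Gbij _ _ Gcan Gg; have [g' gg' g'g] := Gbij _ Gg.
by exists g'; split=> //; exact: Gcan gg'.
Qed.

End PermutationGroup.

Section Invariant.
Variables (T : choiceType) (C : Type) (k : T -> T -> C) (Gamma : set (C -> C)).
Hypotheses (kT : colored_pretree k) (hGamma : permutation_group Gamma).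

Lemma odds_map (U V : choiceType) (f : U -> V) s : odds (map f s) = map f (odds s).
Proof.
have [m sm] := ubnP (size s); elim: m s sm => // m IHm [|x [|y s]] //= sm.
by rewrite IHm // -ltnS ltnW.
Qed.

Lemma partial_iso_of_tuples m (s s' : m.-tuple T) :
  median_closed k [set` s] -> median_closed k [set` s'] ->
  (forall i j, (tnth s i == tnth s j) = (tnth s' i == tnth s' j)) ->
  (forall i, diagonal_orbit Gamma [tuple k (tnth s i) (tnth s j) | j < m] =
             diagonal_orbit Gamma [tuple k (tnth s' i) (tnth s' j) | j < m]) ->
  exists L, partial_iso k Gamma L /\
    forall i, exists e, [/\ L e, src e = tnth s i & tgt e = tnth s' i].
Proof.
move=> cs cs' ss' oss'.
have /choice[g gP] i : exists g : (C -> C) * (C -> C),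
    [/\ Gamma g.1, Gamma g.2, cancel g.1 g.2 & cancel g.2 g.1] /\
    forall j, g.1 (k (tnth s i) (tnth s j)) = k (tnth s' i) (tnth s' j).
  have [a Ga aP] := diagonal_orbit_eq hGamma (oss' i).
  have [b [Gb ab ba]] := permutation_group_inv hGamma Ga.
  exists (a, b); split=> // j.
  by have /(congr1 (fun t => tnth t j)) := aP; rewrite tnth_map !tnth_mktuple.
(* The tuples may repeat entries. Taking the action chosen at the first occurrence [r i] makes the
   local isomorphism [E i] depend on the entry alone. *)
have idx i : (index (tnth s i) s < m)%N.
  by rewrite -[X in (_ < X)%N](size_tuple s) index_mem mem_tnth.
pose r i := Ordinal (idx i).
have rs i : tnth s (r i) = tnth s i.
  by rewrite (tnth_nth (tnth s i)) nth_index ?mem_tnth.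
have rs' i : tnth s' (r i) = tnth s' i by apply/eqP; rewrite -ss' rs.
have rE i j : tnth s i = tnth s j -> r i = r j.
  by move=> e; apply/val_inj; rewrite /= e.
pose E i := LocalIso (tnth s i) (tnth s' i) (g (r i)).1 (g (r i)).2.
have EE i j : tnth s i = tnth s j -> E i = E j.
  move=> e; rewrite /E (rE _ _ e) e; congr LocalIso.
  by apply/eqP; rewrite -ss' e.
have imE (u : m.-tuple T) : range (tnth u) = [set` u].
  apply/seteqP; split=> x /=; first by move=> [i _ <-]; exact: mem_tnth.
  by move=> /tnthP[i ->]; exists i.
exists (range E); split; last by move=> i; exists (E i); split.
split.
- by apply: finite_image; exact: finite_finset.
- by move=> _ [i _ <-]; have [] := gP (r i).
- by move=> _ _ [i _ <-] [j _ <-]; exact: EE.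
- move=> _ _ [i _ <-] [j _ <-] /= /eqP; rewrite -ss' => /eqP; exact: EE.
- move=> _ _ [i _ <-] [j _ <-] _ /=; have [_ gE] := gP (r i).
  by rewrite -(rs i) -(rs' i) gE.
- by rewrite image_comp (_ : _ \o _ = tnth s) ?imE.
- by rewrite image_comp (_ : _ \o _ = tnth s') ?imE.
Qed.

Lemma colored_auto_invariant d : countable [set: T] -> oligomorphic Gamma ->
  exists (I : finType) (inv : d.-tuple T -> I), forall t t', inv t = inv t' ->
    exists phi psi gamma delta,
      colored_auto k Gamma phi psi gamma delta /\ map_tuple phi t = t'.
Proof.
move=> cT oG; have [N [code codeP]] := finite_code (oG d.*2).
have /choice[h hP] (t : d.-tuple T) : exists s : d.*2.-tuple T,
    odds s = t /\ median_closed k [set` s].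
  have [s [ss os cs]] := median_hull kT t.
  have /eqP ss' : size s = d.*2 by rewrite ss size_tuple.
  by exists (Tuple ss').
(* The equality pattern of the hull and the orbits of the color tuples at its entries. The diagonal
   colors are junk and merely refine the invariant. *)
pose inv t : {ffun 'I_d.*2 * 'I_d.*2 -> bool} * {ffun 'I_d.*2 -> 'I_N.+1} :=
  ([ffun ij => tnth (h t) ij.1 == tnth (h t) ij.2],
   [ffun i => code (diagonal_orbit Gamma
                      [tuple k (tnth (h t) i) (tnth (h t) j) | j < d.*2])]).
exists _, inv => t t' [/ffunP e1 /ffunP e2].
have [ot ct] := hP t; have [ot' ct'] := hP t'.
have [L [pL LP]] : exists L, partial_iso k Gamma L /\
    forall i, exists e, [/\ L e, src e = tnth (h t) i & tgt e = tnth (h t') i].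
  apply: partial_iso_of_tuples => //.
    by move=> i j; have := e1 (i, j); rewrite !ffunE.
  by move=> i; have := e2 i; rewrite !ffunE => /codeP; apply; exact: imageP.
have Gid : Gamma id by case: hGamma.
have [phi [psi [gamma [delta [ca phiP]]]]] := back_and_forth kT Gid cT pL.
exists phi, psi, gamma, delta; split=> //.
apply/val_inj; rewrite /= -ot -ot' -odds_map; congr odds.
have -> : val (h t') = val (map_tuple phi (h t)) => //.
congr val; apply: eq_from_tnth => i; rewrite tnth_map.
by have [e [Le <- <-]] := LP i; rewrite phiP.
Qed.

End Invariant.

(** * Cut points *)

Lemma metrizable_hausdorff (R : realType) (X : topologicalType) :
  metrizable R X -> hausdorff_space X.
Proof.
move=> [d [d0 dC dtri dnbhs]] p q pq; apply: contrapT => npq.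
have dpos : (0 < d p q)%R.
  have d_ge0 : (0 <= d p q)%R.
    have := dtri p q p; rewrite (dC q p) ((d0 p p).2 erefl) -mulr2n.
    by rewrite pmulrn_lge0.
  by rewrite lt_neqAle d_ge0 andbT eq_sym; apply/eqP => /d0.
have e0 : (0 < d p q / 2)%R by rewrite divr_gt0.
have nb x : nbhs x [set y | (d x y < d p q / 2)%R] by apply/dnbhs; exists (d p q / 2)%R.
have [z [/= pz qz]] := pq _ _ (nb p) (nb q).
have := dtri p z q; rewrite (dC z q) leNgt => /negP; apply.
by rewrite [ltRHS]splitr ltrD.
Qed.

Lemma compact_fip (X : topologicalType) (I : choiceType) (f : I -> set X) :
  compact [set: X] -> (forall i, closed (f i)) ->
  (forall s : seq I, exists p, forall i, i \in s -> f i p) ->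
  exists q, forall i, f i q.
Proof.
move=> cX fcl ffin.
have [[i0]|nI] := pselect (exists i : I, True); last first.
  by have [p _] := ffin [::]; exists p => i; exfalso; apply: nI; exists i.
have fI : finI [set: I] f.
  move=> D _; have [p fp] := ffin (finmap.enum_fset D).
  by exists p => i /= iD; exact: fp.
have PF := finI_filter fI.
have [|q [_ cq]] := cX _ PF.
  by exists (f i0) => //; exact: finI_from1.
exists q => i; apply: (fcl i) => A Aq.
by apply: cq => //; exists (f i) => //; exact: finI_from1.
Qed.

Section CutPoints.
Variable X : topologicalType.
Hypotheses (hT2 : hausdorff_space X) (conX : connected [set: X])
  (lcX : locally_connected X).

Local Notation comp := (@component_at X).
Local Notation sep := (separates comp).
Implicit Types (x y z p q w : X) (A U : set X).

Lemma closed_point z : closed [set z].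
Proof. exact/accessible_closed_set1/hausdorff_accessible. Qed.

Lemma comp_refl z p : p <> z -> comp z p p.
Proof. by move=> pz; exact: connected_component_refl. Qed.

Lemma comp_neq z p q : comp z p q -> q <> z.
Proof. by move=> /connected_component_sub. Qed.

Lemma comp_eq z p q : comp z p q -> comp z p = comp z q.
Proof. exact: same_connected_component. Qed.

Lemma comp_eqP z p q : q <> z -> comp z p = comp z q <-> comp z p q.
Proof. by move=> qz; split=> [->|]; [exact: comp_refl|exact: comp_eq]. Qed.

(** The set [comp z z] is empty, because [z] is not in the complement of [z]. *)
Lemma comp_eq_neq z p q : q <> z -> comp z p = comp z q -> p <> z.
Proof.
move=> qz e pz; have : comp z p q by rewrite e; exact: comp_refl.
by rewrite pz /component_at connected_component_out //; exact.
Qed.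

Lemma comp_connected z p : connected (comp z p).
Proof. exact: component_connected. Qed.

Lemma comp_eq_connected A z p q :
  connected A -> ~ A z -> A p -> A q -> comp z p = comp z q.
Proof.
move=> Ac Az Ap Aq; apply: comp_eq; exists A => //; split=> // x Ax /= xz.
by apply: Az; rewrite -xz.
Qed.

Lemma comp_open z p : open (comp z p).
Proof.
rewrite openE => q pq; have qz := comp_neq pq.
have /lcX[V [oV cV Vq Vz]] : nbhs q (~` [set z]).
  by apply: open_nbhs_nbhs; split=> //; exact/closed_openC/closed_point.
rewrite (comp_eq pq); apply: (@filterS _ _ _ V); last exact: open_nbhs_nbhs.
exact: connected_component_max.
Qed.

Lemma comp_closure_closed z p : closed (z |` comp z p).
Proof.
rewrite -[_ `|` _]setCK; apply: open_closedC; rewrite openE => q /=.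
move=> /not_orP[qz npq]; have := comp_open z q; rewrite openE => /(_ q (comp_refl qz)).
apply: filterS => r qr /= [rz|pr]; first exact: (comp_neq qr).
by apply: npq; rewrite (comp_eq pr) -(comp_eq qr); exact: comp_refl.
Qed.

(** The open set [comp z p] has [z] in its closure, as otherwise it would be clopen in the connected
    space; so the set in question is the closure of a connected set. *)
Lemma comp_point_connected z p : p <> z -> connected (z |` comp z p).
Proof.
move=> pz; have clC : closure (comp z p) `<=` z |` comp z p.
  rewrite [X in _ `<=` X](closure_id _).1; last exact: comp_closure_closed.
  by apply: closureS => q; right.
have clz : closure (comp z p) z.
  apply: contrapT => nz; have cl : closed (comp z p).
    by move=> q /[dup] qcl /clC[qz|//]; rewrite qz in qcl.
  have CT : comp z p = [set: X].
    apply: conX; first by exists p; exact: comp_refl.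
    - by exists (comp z p); rewrite ?setTI //; exact: comp_open.
    - by exists (comp z p); rewrite ?setTI.
  by have /comp_neq : comp z p z by rewrite CT.
have -> : z |` comp z p = closure (comp z p).
  apply/seteqP; split=> // q [->//|]; exact: subset_closure.
exact/connected_closure/comp_connected.
Qed.

(** The component of [x] at [w], together with [w], is a connected set that avoids [f]. *)
Lemma comp_stepwise : stepwise comp.
Proof.
move=> w x f [xw fw ne]; apply: (@comp_eq_connected (w |` comp w x)).
- exact: comp_point_connected.
- by move=> [//|/comp_eq].
- by right; exact: comp_refl.
- by left.
Qed.

Lemma shadow_open q u : open [set v | sep q u v].
Proof.
rewrite openE => v /= [uq vq ne].
have := comp_open q v; rewrite openE => /(_ v (comp_refl vq)).
apply: filterS => r /[dup] qr /comp_neq rq; split=> //.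
by rewrite -(comp_eq qr).
Qed.

(** If [z] leaves [q] and [z1] together, it separates both from [v]. So [z1] sees [v] and [z] in one
    direction, which is not that of [q]. *)
Lemma separators_nested z z1 q v : sep z q v -> sep z1 q v -> z <> z1 ->
  sep z q z1 \/ sep z1 q z.
Proof.
move=> s s1 zz1; have [qz vz ne] := s; have [qz1 vz1 ne1] := s1.
have [h|h] := pselect (sep z q z1); [by left|right].
have e : comp z q = comp z z1.
  by apply: contrapT => n; apply: h; split=> //; exact/nesym.
have /comp_stepwise e1 : sep z v z1.
  by split=> //; [exact/nesym|rewrite -e; exact/nesym].
by split=> //; rewrite -e1.
Qed.

Variable B : set X.
Hypothesis dense : forall x y, x <> y -> exists2 z, B z & sep z x y.

(* "Some point of [B] separates [q] from both" is an equivalence relation with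
   open classes on each component of the complement of [q]. *)
Lemma comp_eq_shadow q u v : u <> q -> comp q u = comp q v ->
  exists2 z, B z & sep z q u /\ sep z q v.
Proof.
move=> uq uv; have vq : v <> q by apply: (comp_eq_neq uq); rewrite uv.
pose E := [set a | exists2 z, B z & sep z q u /\ sep z q a].
pose N := [set a | a <> q /\ ~ E a].
have shadow_nbhs z a : sep z q a -> nbhs a [set b | sep z q b].
  by move=> qa; apply: open_nbhs_nbhs; split=> //; exact: shadow_open.
have oE : open E.
  rewrite openE => a [z Bz [qu qa]]; apply: filterS (shadow_nbhs _ _ qa) => b qb.
  by exists z.
have oN : open N.
  (* If a point [b] in the shadow of [z] were in [E] through [z1], then [z] and [z1] would be
     nested, and whichever is nearer to [q] would put [a] in [E]. *)
  rewrite openE => a [aq nEa]; have [z Bz qa] := dense (nesym aq).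
  apply: filterS (shadow_nbhs _ _ qa) => b qb; split; first exact: (nesym (separates_neq qb)).
  move=> [z1 Bz1 [qu1 qb1]]; apply: nEa.
  have [e|zz1] := pselect (z = z1); first by exists z => //; split=> //; rewrite e.
  have [h|h] := separators_nested qb qb1 zz1.
    by exists z => //; split=> //; exact: (separates_trans comp_stepwise h qu1).
  by exists z1 => //; split=> //; exact: (separates_trans comp_stepwise h qa).
have CE : comp q u `&` E = comp q u.
  apply: comp_connected; [|by exists E|exists (~` N); first exact: open_closedC].
    have [z Bz qu] := dense (nesym uq).
    by exists u; split; [exact: comp_refl|exists z].
  apply/seteqP; split=> a [ua Ea]; split=> //; first by move=> [_ /(_ Ea)].
  by apply: contrapT => nEa; apply: Ea; split=> //; exact: comp_neq ua.
have : comp q u v by apply/comp_eqP.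
by rewrite -CE => -[].
Qed.

(* If there is no center, each [w] has a component containing two of [x], [y],
   [z]; [D w] is its closure.  The sets [D w] have the finite intersection
   property, and a common point of all of them is a center. *)
Lemma center_exists x y z : compact [set: X] ->
  ~ sep x y z -> ~ sep y x z -> ~ sep z x y -> x <> y -> y <> z -> x <> z ->
  exists w, [/\ sep w x y, sep w y z & sep w x z].
Proof.
move=> cX nx ny nz xy yz xz; apply: contrapT => nc.
pose maj w p := [\/ comp w p = comp w x /\ comp w p = comp w y,
  comp w p = comp w y /\ comp w p = comp w z |
  comp w p = comp w x /\ comp w p = comp w z].
have exmaj w : exists2 p, p <> w & maj w p.
  have [->|xw] := pselect (w = x).
    exists y; first exact/nesym.
    by apply: Or32; split=> //; apply: color_nonseparated nx => //; exact/nesym.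
  have [->|yw] := pselect (w = y).
    by exists x => //; apply: Or33; split=> //; apply: color_nonseparated ny => //; exact/nesym.
  have [->|zw] := pselect (w = z).
    by exists x => //; apply: Or31; split=> //; exact: color_nonseparated nz.
  have [xy'|xy'] := pselect (comp w x = comp w y).
    by exists x; [exact/nesym|apply: Or31].
  have [yz'|yz'] := pselect (comp w y = comp w z).
    by exists y; [exact/nesym|apply: Or32].
  have [xz'|xz'] := pselect (comp w x = comp w z).
    by exists x; [exact/nesym|apply: Or33].
  by exfalso; apply: nc; exists w; split; split=> //; exact/nesym.
have maj_eq w p q : maj w p -> maj w q -> comp w p = comp w q.
  by move=> [[e1 e2]|[e1 e2]|[e1 e2]] [[e3 e4]|[e3 e4]|[e3 e4]];
    rewrite ?e1 ?e3 -?e2 -?e4 ?e1 ?e3 //; congruence.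
pose D w := [set p | p = w \/ (p <> w /\ maj w p)].
have DE w p : p <> w -> maj w p -> D w = w |` comp w p.
  move=> pw mp; apply/seteqP; split=> q.
    move=> [|[qw mq]]; [by left|right].
    by apply/(comp_eqP _ qw); exact: maj_eq.
  move=> [|pq]; [by left|right]; split; first exact: comp_neq pq.
  by rewrite /maj -(comp_eq pq).
have Dcl w : closed (D w).
  by have [p pw mp] := exmaj w; rewrite (DE _ _ pw mp); exact: comp_closure_closed.
(* The connected set [D v] contains two of the three points; if it misses [w], it lies within one
   component at [w], hence in [D w]. *)
have Dmaj v w p : ~ D v w -> D v p -> D w p.
  move=> nw vp; have pw : p <> w by move=> e; apply: nw; rewrite -e.
  right; split=> //; have [a av ma] := exmaj v.
  have Dc : connected (D v) by rewrite (DE _ _ av ma); exact: comp_point_connected.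
  have Din b : comp v a = comp v b -> D v b.
    move=> e; rewrite (DE _ _ av ma); right.
    by rewrite e; apply: comp_refl; exact: (comp_eq_neq av (esym e)).
  have same b : comp v a = comp v b -> comp w p = comp w b.
    by move=> /Din vb; exact: (comp_eq_connected Dc nw).
  by case: ma => -[/same e1 /same e2]; [apply: Or31|apply: Or32|apply: Or33].
(* A member of [s] itself serves as common point. If the old one [p] is not in [D v], then [v]
   serves: were [v] outside [D i], [Dmaj] would carry [p] from [D i] into [D v]. *)
have Dfin (s : seq X) : s != [::] -> exists2 j, j \in s & forall i, i \in s -> D i j.
  elim: s => [|v s IHs] // _; have [->|/IHs[p ps pD]] := eqVneq s [::].
    by exists v; rewrite ?mem_head // => i; rewrite inE => /eqP->; left.
  have [vp|nvp] := pselect (D v p).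
    by exists p; rewrite ?inE ?ps ?orbT // => i; rewrite inE => /orP[/eqP->|/pD].
  exists v; rewrite ?mem_head // => i; rewrite inE => /orP[/eqP->|is_]; first by left.
  by apply: contrapT => niv; apply: nvp; apply: (Dmaj _ _ _ niv); exact: pD.
have [q qD] : exists q, forall w, D w q.
  apply: compact_fip => // s; have [->|/Dfin[j _ jD]] := eqVneq s [::]; last by exists j.
  by exists x.
(* If [q] sees two of the points in one component, some [w] separates [q] from both. But at [w] the
   point [q] lies with two of the three, hence with one of these. *)
have K a b : a <> q -> comp q a = comp q b ->
    (forall w, maj w q -> comp w q = comp w a \/ comp w q = comp w b) -> False.
  move=> aq /(comp_eq_shadow aq)[w Bw [[qw _ na] [_ _ nb]]] h.
  by case: (qD w) => // -[_ /h[]].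
have Kxy : x <> q -> comp q x <> comp q y.
  by move=> xq e; apply: (K _ _ xq e) => w [[]|[]|[]]; tauto.
have Kyz : y <> q -> comp q y <> comp q z.
  by move=> xq e; apply: (K _ _ xq e) => w [[]|[]|[]]; tauto.
have Kxz : x <> q -> comp q x <> comp q z.
  by move=> xq e; apply: (K _ _ xq e) => w [[]|[]|[]]; tauto.
have [xq|xq] := pselect (x = q).
  by rewrite -xq in Kyz; apply: (Kyz (nesym xy)); apply: color_nonseparated nx; exact/nesym.
have [yq|yq] := pselect (y = q).
  by rewrite -yq in Kxz; apply: (Kxz xy); apply: color_nonseparated ny => //; exact/nesym.
have [zq|zq] := pselect (z = q).
  by rewrite -zq in Kxy; apply: (Kxy xz); exact: color_nonseparated nz.
by apply: nc; exists q; split; split=> //; auto.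
Qed.

(** From [b], at most one of the three points lies in the direction of [b']. The other two are then
    both seen from [b'] in the direction of [b]. *)
Lemma center_unique b b' x y z : sep b x y -> sep b y z -> sep b x z ->
  sep b' x y -> sep b' y z -> sep b' x z -> b = b'.
Proof.
move=> [xb yb nxy] [_ zb nyz] [_ _ nxz] [_ _ nxy'] [_ _ nyz'] [_ _ nxz'].
apply: contrapT => bb'.
have away a : a <> b -> comp b a <> comp b b' -> comp b' a = comp b' b.
  by move=> ab ne; apply: comp_stepwise; split=> //; exact/nesym.
have [xb'|/(away _ xb) xb'] := pselect (comp b x = comp b b').
  apply: nyz'; rewrite !away //; first by rewrite -xb'; exact/nesym.
  by rewrite -xb'; exact/nesym.
have [yb'|/(away _ yb) yb'] := pselect (comp b y = comp b b').
  apply: nxz'; rewrite !away //; first by rewrite -yb'; exact/nesym.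
  by rewrite -yb'.
by apply: nxy'; rewrite xb' yb'.
Qed.

(** A connected set with two points contains every point separating them. A connected open
    neighborhood reduced to [p] would be clopen. *)
Lemma nbhs_meets U p : (exists q, q <> p) -> nbhs p U -> exists2 b, B b & U b.
Proof.
move=> [q qp] /lcX[V [oV cV Vp VU]].
have [[p' [Vp' p'p]]|nV] := pselect (exists p', V p' /\ p' <> p).
  have [z Bz zpp'] := dense p'p; exists z => //; apply: VU.
  apply: contrapT => nVz; case: zpp' => _ _; apply.
  exact: comp_eq_connected cV nVz Vp' Vp.
have VE : V = [set p].
  apply/seteqP; split=> r; last by move=> ->.
  by move=> Vr; apply: contrapT => rp; apply: nV; exists r.
have VT : V = [set: X].
  apply: conX; first by exists p.
  - by exists V; rewrite ?setTI.
  - by exists V; rewrite ?setTI // VE; exact: closed_point.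
by exfalso; apply: qp; have : V q by [rewrite VT]; rewrite VE.
Qed.

End CutPoints.

(** * Branch points as centers of triples *)

Lemma Br_separates (X : topologicalType) (w x y z : X) :
  let sep := separates (@component_at X) in
  sep w x y -> sep w y z -> sep w x z -> Br X w.
Proof.
move=> sep [xw yw nxy] [_ zw nyz] [_ _ nxz].
pose g n : set X := component_at w (nth z [:: x; y] n).
apply/pcard_leP/injfunPex; exists g.
  by case=> [|[|[|n]]] n3; [exists x|exists y|exists z|].
move=> i j; rewrite !inE.
case: i => [|[|[|i]]] i3; case: j => [|[|[|j]]] j3 // e; exfalso.
- exact: (nxy (esym e)).
- exact: (nxz (esym e)).
- exact: (nyz (esym e)).
Qed.

Lemma Br_hat3 (X : topologicalType) (w : X) : Br X w ->
  exists x y z, let sep := separates (@component_at X) in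
  [/\ sep w x y, sep w y z & sep w x z].
Proof.
move=> /pcard_leP/injfunPex[g gfun ginj].
have [x xw gx] := gfun 0%N erefl; have [y yw gy] := gfun 1%N erefl.
have [z zw gz] := gfun 2%N erefl.
have ne i j : (i < 3)%N -> (j < 3)%N -> i != j -> g i <> g j.
  by move=> i3 j3 /eqP ij gij; apply: ij; apply: ginj; rewrite ?inE.
exists x, y, z; split; split=> //; rewrite ?gx ?gy ?gz; exact: ne.
Qed.

(** * Branch points on arcs *)

Section Arcs.
Variables (R : realType) (X : topologicalType).
Local Notation comp := (@component_at X).
Local Notation sep := (separates comp).
Local Open Scope ring_scope.

Section Arc.
Variables (f : R -> X) (A : set X).
Hypothesis fA : homeomorphism_between (`[0, 1] : set R) A f.

Lemma arc_connected s t : 0 <= s -> t <= 1 -> connected (f @` `[s, t]).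
Proof.
move=> s0 t1; apply: connected_continuous_connected; first exact: segment_connected.
case: fA => fc _; apply: continuous_subspaceW fc => r /=.
by rewrite !in_itv /=; lra.
Qed.

Lemma arc_inj s t : 0 <= s <= 1 -> 0 <= t <= 1 -> f s = f t -> s = t.
Proof.
case: fA => _ [g [_ _ _ fK _]] s01 t01 fst.
by rewrite -[s]fK ?inE /= ?in_itv //= fst fK // inE /= in_itv.
Qed.

Lemma arc_avoid r s t : 0 <= r <= 1 -> 0 <= s -> s <= t -> t <= 1 ->
  r < s \/ t < r -> comp (f r) (f s) = comp (f r) (f t).
Proof.
move=> r01 s0 st t1 rst.
apply: (comp_eq_connected (arc_connected s0 t1)).
- move=> [u /=]; rewrite in_itv /= => ust /arc_inj ur.
  have /ur/(_ r01) e : 0 <= u <= 1 by lra.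
  by rewrite e in ust; lra.
- by exists s => //=; rewrite in_itv /=; lra.
- by exists t => //=; rewrite in_itv /=; lra.
Qed.

Lemma arc_cross z s t : 0 <= s -> s <= t -> t <= 1 -> sep z (f s) (f t) ->
  exists2 r, s < r < t & f r = z.
Proof.
move=> s0 st t1 [sz tz ne]; apply: contrapT => nr; apply: ne.
apply: (comp_eq_connected (arc_connected s0 t1)).
- move=> [u /=]; rewrite in_itv /= => /andP[su ut] uz; apply: nr; exists u => //.
  rewrite !lt_neqAle su ut !andbT; apply/andP; split; apply/eqP => e.
    by apply: sz; rewrite e.
  by apply: tz; rewrite -e.
- by exists s => //=; rewrite in_itv /=; lra.
- by exists t => //=; rewrite in_itv /=; lra.
Qed.

Hypothesis branch_sep : forall u v, Br X u -> Br X v -> u <> v ->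
  exists2 z, Br X z & sep z u v.

(** A separator of the two branch points lies on the connected piece of arc between them. The outer
    pieces avoid it, so it separates the ends of the whole arc too. *)
Lemma arc_branch_separates s t : 0 <= s -> s < t -> t <= 1 ->
  Br X (f s) -> Br X (f t) ->
  exists2 r, s < r < t & Br X (f r) /\ sep (f r) (f 0) (f 1).
Proof.
move=> s0 st t1 Bs Bt.
have [|z Bz zst] := branch_sep Bs Bt.
  move=> /arc_inj e; have {}e : s = t by apply: e; lra.
  by exfalso; move: e; lra.
have [r rst rz] := arc_cross s0 (ltW st) t1 zst.
have r01 : 0 <= r <= 1 by lra.
exists r; rewrite // rz; split=> //; have [_ _ ne] := zst; split.
- rewrite -rz => /arc_inj e; have {}e : 0 = r by apply: e; lra.
  by exfalso; move: e; lra.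
- rewrite -rz => /arc_inj e; have {}e : 1 = r by apply: e; lra.
  by exfalso; move: e; lra.
- have e0 : comp (f r) (f 0) = comp (f r) (f s) by apply: arc_avoid => //; lra.
  have e1 : comp (f r) (f t) = comp (f r) (f 1) by apply: arc_avoid => //; lra.
  by rewrite -rz e0 -e1 rz.
Qed.

End Arc.

Lemma open_arcP x y w : open_arc R x y w -> exists (f : R -> X) A t,
  [/\ homeomorphism_between (`[0, 1] : set R) A f, f 0 = x, f 1 = y, 0 < t < 1 &
      f t = w].
Proof.
(* The default value of [arc_between] is empty, so a point in it forces an arc to exist. *)
move=> [Aw nxy]; have [[A0 xyA0]|nA] := pselect (exists A, is_arc R x y A); last first.
  move: Aw; rewrite /arc_between xgetPN // => A hA; apply: nA; by exists A.
have [f [fA f0 f1]] : is_arc R x y (arc_between R x y).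
  by apply: (@xgetPex _ set0 (is_arc R x y)); exists A0.
have [_ [g [_ _ gfun _ gK]]] := fA.
have := gfun _ Aw; rewrite /= in_itv /= => /andP[g0 g1].
have gw : f (g w) = w by apply: gK; rewrite inE.
exists f, (arc_between R x y), (g w); split=> //.
rewrite !lt_neqAle g0 g1 !andbT; apply/andP; split; apply/eqP => e; apply: nxy.
  by left; rewrite /= -gw -e.
by right; rewrite /= -gw e.
Qed.

Hypothesis branch_sep : forall u v, Br X u -> Br X v -> u <> v ->
  exists2 z, Br X z & sep z u v.
Hypothesis branch_arc : forall x y : X, x <> y -> open_arc R x y `&` Br X !=set0.

(* An arc with two branch points contains a branch point that separates its
   ends.  The given arc [x, y] meets [Br] in some [w]; a separator of [x] and [w]
   produced on the arc [x, w] lies on [x, y] too, giving a second branch point. *)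
Lemma branch_dense x y : x <> y -> exists2 z, Br X z & sep z x y.
Proof.
move=> xy; have [w [/open_arcP[f [A [t [fA f0 f1 t01 ft]]]] Bw]] := branch_arc xy.
have xw : x <> w.
  rewrite -f0 -ft => /(arc_inj fA) e; have {}e : 0 = t by apply: e; lra.
  by exfalso; move: e; lra.
have [w' [/open_arcP[f' [A' [s [f'A' f'0 f'1 s01 fs]]]] Bw']] := branch_arc xw.
have [r rs1 [Br' sepr]] : exists2 r, s < r < 1 &
    Br X (f' r) /\ sep (f' r) (f' 0) (f' 1).
  by apply: (arc_branch_separates f'A'); rewrite ?fs ?f'1 //; lra.
rewrite f'0 f'1 -f0 -ft in sepr.
have [||| q q0t fq] := arc_cross fA _ _ _ sepr; [lra|lra|lra|].
have [p p0 [Bp sepp]] : exists2 p, q < p < t & Br X (f p) /\ sep (f p) (f 0) (f 1).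
  by apply: (arc_branch_separates fA); rewrite ?fq ?ft //; lra.
by exists (f p); rewrite -?f0 -?f1.
Qed.

End Arcs.

(** * Countability of the set of branch points *)

Section Countable.
Local Open Scope ring_scope.

Lemma compact_metrizable_dense (R : realType) (X : topologicalType) :
  compact [set: X] -> metrizable R X ->
  exists2 D : set X, countable D &
    forall (p : X) (U : set X), nbhs p U -> exists2 q, D q & U q.
Proof.
move=> cX [d [d0 dC dtri dnbhs]].
have ball_open p (e : R) : open [set q | d p q < e].
  rewrite openE => q /= pq; apply/dnbhs; exists (e - d p q); first by rewrite subr_gt0.
  by move=> r /= qr; have := dtri p q r; lra.
(* Finite nets: if none existed, the complements of the balls would have a common point by
   compactness. *)
have /choice[s sP] (m : nat) : exists s : seq X,
    forall p, exists2 i, i \in s & d i p < m.+1%:R^-1.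
  apply: contrapT => ns.
  have [|s|q qP] := compact_fip (f := fun i => ~` [set p | d i p < m.+1%:R^-1]) cX.
  - by move=> i; exact/open_closedC/ball_open.
  - apply: contrapT => np; apply: ns; exists s => p; apply: contrapT => ni.
    by apply: np; exists p => i si /= ip; apply: ni; exists i.
  - by apply: (qP q) => /=; rewrite (d0 q q).2 // invr_gt0 ltr0n.
exists (\bigcup_m [set` s m]).
  apply: bigcup_countable; first exact: countableP.
  by move=> m _; apply: finite_set_countable; exact: finite_seq.
move=> p U /dnbhs[e e0 eU].
have [m me] : exists m : nat, m.+1%:R^-1 < e.
  have [m em] : exists m : nat, e^-1 < m.+1%:R.
    exists (Num.truncn e^-1); exact: truncnS_gt.
  by exists m; rewrite invf_plt ?posrE ?ltr0n.
have [i si ip] := sP m p; exists i; first by exists m.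
by apply: eU; rewrite /= dC; exact: lt_trans me.
Qed.

(** Components are open, so each branch point is a center of three points of a countable dense set,
    and a triple has at most one center. *)
Lemma Br_countable (R : realType) (X : topologicalType) :
  dendrite R X -> countable (Br X).
Proof.
move=> [[_ cX conX mX] lcX _]; have hT2 := metrizable_hausdorff mX.
have [D cD densD] := compact_metrizable_dense cX mX.
pose sep := separates (@component_at X).
pose F x y z := [set w | [/\ sep w x y, sep w y z & sep w x z]].
apply: (@sub_countable _ _ _ (\bigcup_(x in D) \bigcup_(y in D) \bigcup_(z in D) F x y z)).
  apply: subset_card_le => w /Br_hat3[x [y [z [xy yz xz]]]].
  have pick u v : sep w u v -> exists2 q, D q & component_at w u = component_at w q.
    move=> [uw _ _]; have [|q Dq uq] := densD u (component_at w u).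
      by apply: open_nbhs_nbhs; split; [exact: comp_open|exact: comp_refl].
    by exists q => //; exact: comp_eq.
  have sep' u v u' v' : component_at w u = component_at w u' ->
      component_at w v = component_at w v' -> sep w u v -> sep w u' v'.
    move=> e1 e2 [uw vw ne]; split; [|
      |by rewrite -e1 -e2]; apply: comp_eq_neq; [exact: uw|exact/esym|
      exact: vw|exact/esym].
  have [x' Dx ex] := pick _ _ xy; have [y' Dy ey] := pick _ _ yz.
  have [z' Dz ez] := pick _ _ (separatesC yz).
  exists x' => //; exists y' => //; exists z' => //.
  by split; [exact: sep' xy|exact: sep' yz|exact: sep' xz].
apply: bigcup_countable => // x _; apply: bigcup_countable => // y _.
apply: bigcup_countable => // z _.
have [->|/set0P[w [xy yz xz]]] := eqVneq (F x y z) set0; first exact: countable0.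
apply: (@sub_countable _ _ _ [set w]); last exact: countable1.
apply: subset_card_le => w' [xy' yz' xz'].
exact: (center_unique hT2 conX lcX xy' yz' xz' xy yz xz).
Qed.

End Countable.

(** * Colors and homeomorphisms *)

Section Coloring.
Variables (X : topologicalType) (n : option nat) (c : X -> set X -> colors n).
Hypothesis hc : is_coloring c.

Local Notation comp := (@component_at X).
Local Notation sep := (separates comp).

Definition color_of (x p : X) : colors n := c x (comp x p).

Lemma comp_hat x p : p <> x -> hat x (comp x p).
Proof. by exists p. Qed.

Lemma color_invP x i : Br X x -> hat x (color_inv c x i) /\ c x (color_inv c x i) = i.
Proof.
move=> Bx; have [_ _ /(_ i Logic.I)[C hC cC]] := hc Bx.
by apply: (@xgetPex _ set0 [set C | hat x C /\ c x C = i]); exists C.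
Qed.

Lemma color_invK x C : Br X x -> hat x C -> color_inv c x (c x C) = C.
Proof.
move=> Bx hC; have [h1 h2] := color_invP (c x C) Bx.
by have [_ inj _] := hc Bx; apply: inj; rewrite ?inE.
Qed.

Lemma color_inv_color_of x p : Br X x -> p <> x ->
  color_inv c x (color_of x p) = comp x p.
Proof. by move=> Bx px; apply: color_invK => //; exact: comp_hat. Qed.

Lemma color_inv_mem x i p : Br X x ->
  color_inv c x i p <-> p <> x /\ color_of x p = i.
Proof.
move=> Bx; split=> [|[px <-]]; last by rewrite color_inv_color_of //; exact: comp_refl.
have [[q qx qC] ci] := color_invP i Bx; rewrite -qC => qp.
by split; [exact: comp_neq qp|rewrite /color_of -(comp_eq qp) qC].
Qed.

Lemma color_of_eqP x p q : Br X x -> p <> x -> q <> x ->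
  color_of x p = color_of x q <-> comp x p = comp x q.
Proof.
move=> Bx px qx; split=> [e|]; last by rewrite /color_of => ->.
by rewrite -!color_inv_color_of // e.
Qed.

Lemma color_separates z x y : Br X z -> separates color_of z x y <-> sep z x y.
Proof.
move=> Bz; split=> -[xz yz ne]; split=> // e; apply: ne.
  by rewrite /color_of e.
exact/color_of_eqP.
Qed.

End Coloring.

Section HomeoAction.
Variables (X : topologicalType) (n : option nat) (c : X -> set X -> colors n).
Hypothesis hc : is_coloring c.
Local Notation comp := (@component_at X).

Lemma continuous_comp_sub (g g' : X -> X) x y p : continuous g -> cancel g g' ->
  comp x y p -> comp (g x) (g y) (g p).
Proof.
move=> gc gK xyp; have yx : y <> x.
  by move=> e; move: xyp; rewrite e /component_at connected_component_out //; exact.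
apply/comp_eqP; first by move=> /(can_inj gK) px; have := comp_neq xyp.
apply: (@comp_eq_connected _ (g @` comp x y)).
- apply: connected_continuous_connected; first exact: comp_connected.
  exact: continuous_subspaceT.
- by move=> [q /comp_neq qx /(can_inj gK)].
- by exists y => //; exact: comp_refl.
- by exists p.
Qed.

Lemma homeo_comp g x y : Homeo X g -> g @` comp x y = comp (g x) (g y).
Proof.
move=> [gc [g' [gc' gK gK']]]; apply/seteqP; split=> q.
  by move=> [p xyp <-]; exact: (continuous_comp_sub gc gK).
move=> xyq; exists (g' q); rewrite ?gK' //.
by have := continuous_comp_sub gc' gK' xyq; rewrite !gK.
Qed.

Lemma sigma_color g x y : Homeo X g -> Br X x -> y <> x ->
  sigma c g x (color_of c x y) = color_of c (g x) (g y).
Proof.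
by move=> hg Bx yx; rewrite /sigma color_inv_color_of // homeo_comp.
Qed.

Lemma Homeo_id : Homeo X id.
Proof. by split; [move=> x; exact: cvg_id|exists id; split=> // x; exact: cvg_id]. Qed.

Lemma Homeo_comp g h : Homeo X g -> Homeo X h -> Homeo X (g \o h).
Proof.
move=> [gc [g' [gc' gK gK']]] [hc' [h' [hc'' hK hK']]]; split.
  by move=> x; apply: continuous_comp; [exact: hc'|exact: gc].
exists (h' \o g'); split; [|exact: can_comp|exact: can_comp].
by move=> x; apply: continuous_comp; [exact: gc'|exact: hc''].
Qed.

Lemma color_ex x (i : colors n) : Br X x -> exists2 y, y <> x & color_of c x y = i.
Proof.
by move=> Bx; have [[y yx yC] e] := color_invP hc i Bx; exists y; rewrite /color_of ?yC.
Qed.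

Variable Gamma : set (colors n -> colors n).
Hypothesis hGamma : permutation_group Gamma.

Lemma induced_id : induced_permutations (Br X) (kaleidoscopic_group c Gamma) id.
Proof.
have [_ Gid _ _] := hGamma; exists id => //; split; first exact: Homeo_id.
move=> x Bx; rewrite (_ : sigma c id x = id) //; apply/funext => i.
have [y yx <-] := color_ex i Bx; rewrite sigma_color //; exact: Homeo_id.
Qed.

Lemma induced_comp g h :
  induced_permutations (Br X) (kaleidoscopic_group c Gamma) g ->
  induced_permutations (Br X) (kaleidoscopic_group c Gamma) h ->
  induced_permutations (Br X) (kaleidoscopic_group c Gamma) (g \o h).
Proof.
move=> [g1 [g1H g1G] gE] [h1 [h1H h1G] hE]; have [_ _ Gcomp _] := hGamma.
exists (g1 \o h1); last by move=> a; rewrite /= gE hE.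
split; first exact: Homeo_comp.
move=> x Bx; have Bhx : Br X (h1 x).
  have := hE (SigSub (mem_set Bx)); rewrite /= => <-.
  exact: set_valP.
(* Cocycle identity for local actions. *)
rewrite (_ : sigma c _ x = sigma c g1 (h1 x) \o sigma c h1 x).
  by apply: Gcomp; [exact: g1G|exact: h1G].
apply/funext => i /=; have [y yx <-] := color_ex i Bx.
rewrite !sigma_color //; last exact: Homeo_comp.
by case: h1H => _ [h' [_ hK _]] /(can_inj hK).
Qed.

End HomeoAction.

Lemma diagonal_orbit_sub (T : Type) (G : set (T -> T)) k (t t' : k.-tuple T) a :
  (forall s u, G s -> G u -> G (s \o u)) -> G a -> map_tuple a t = t' ->
  diagonal_orbit G t' `<=` diagonal_orbit G t.
Proof.
move=> Gcomp Ga <- _ [g Gg <-]; exists (g \o a); first exact: Gcomp.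
by apply/val_inj; rewrite /= map_comp.
Qed.

Lemma colors_alt n (i : colors n) : at_least3 n -> exists j : colors n, i <> j.
Proof.
move=> hn; have in_seg m : (m < 2)%N -> m \in initial_segment n.
  by rewrite inE; case: n hn {i} => //= n n3 m2; lia.
pose col m (h : (m < 2)%N) : colors n := SigSub (in_seg m h).
have [e|ne] := pselect (i = col 0%N erefl); last by exists (col 0%N erefl).
by exists (col 1%N erefl); rewrite e => /(congr1 val).
Qed.

(** * Extending colored automorphisms to homeomorphisms *)

Section Kaleidoscope.
Variables (R : realType) (n : option nat) (hn : at_least3 n).
Variables (X : topologicalType) (hX : wazewski_dendrite R X n).
Variables (c : X -> set X -> colors n) (hc : kaleidoscopic R c).

Local Notation comp := (@component_at X).
Local Notation sep := (separates comp).
Local Notation T := (set_type (Br X)).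
Local Notation col := (color_of c).

Let cc : is_coloring c := hc.1.
Let X_compact : compact [set: X]. Proof. by have [[[]]] := hX. Qed.
Let X_connected : connected [set: X]. Proof. by have [[[]]] := hX. Qed.
Let X_lc : locally_connected X. Proof. by have [[]] := hX. Qed.
Let X_T2 : hausdorff_space X.
Proof. by have [[[_ _ _ mX] _ _] _ _ _] := hX; exact: metrizable_hausdorff mX. Qed.

Let BrT (a : T) : Br X (val a). Proof. exact: set_valP. Qed.

Let toT x (Bx : Br X x) : T := SigSub (mem_set Bx).

Lemma branch_separator u v : Br X u -> Br X v -> u <> v ->
  exists2 z, Br X z & sep z u v.
Proof.
move=> Bu Bv uv; have [_ hk] := hc.
(* Any two distinct colors will do; the color of [p] supplies the first. *)
have [p pu] : exists p, p <> u by exists v; exact/nesym.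
have [j ij] := colors_alt (col u p) hn.
have [z [[[_ nz] Bz] e1 e2]] := hk u v Bu Bv uv _ _ ij.
exists z => //; split.
- by move=> e; apply: nz; left.
- by move=> e; apply: nz; right.
- by move=> e; apply: ij; rewrite -e1 -e2 e.
Qed.

Lemma branch_between x y : x <> y -> exists2 z, Br X z & sep z x y.
Proof.
move=> xy; apply: (@branch_dense R _ branch_separator _ _ _ xy).
by have [_ _ _] := hX.
Qed.

Definition branch_color (a b : T) : colors n := col (val a) (val b).

Lemma branch_separates z x y :
  separates branch_color z x y <-> sep (val z) (val x) (val y).
Proof.
have vI (a b : T) : a <> b <-> val a <> val b.
  by split=> h e; apply: h; [exact: val_inj|rewrite e].
rewrite -(color_separates cc _ _ (BrT z)).
by split=> -[/vI xz /vI yz ne].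
Qed.

Lemma branch_colored_pretree : colored_pretree branch_color.
Proof.
have vI (a b : T) : a <> b -> val a <> val b by move=> h e; apply: h; exact: val_inj.
split.
- move=> w x f /branch_separates /(comp_stepwise X_T2 X_connected X_lc) e.
  by rewrite /branch_color /color_of e.
- move=> x y xy i j ij; have [_ hk] := hc.
  have [z [[[_ nz] Bz] e1 e2]] := hk _ _ (BrT x) (BrT y) (vI _ _ xy) _ _ ij.
  exists (toT Bz); last by [].
  by split=> /(congr1 val) /= e; apply: nz; [left|right].
- move=> x i; have [y yx yi] := color_ex cc i (BrT x).
  (* The point [y] of the wanted color need not be a branch point, but its open component contains
     one. *)
  have [||b Bb yb] := nbhs_meets X_T2 X_connected X_lc branch_between
    (p := y) (U := comp (val x) y).
  + by exists (val x); exact/nesym.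
  + by apply: open_nbhs_nbhs; split; [exact: (comp_open X_T2 X_lc)|exact: comp_refl].
  exists (toT Bb); first by move=> /(congr1 val) /=; exact: comp_neq yb.
  by rewrite /branch_color /color_of /= -(comp_eq yb).
- by move=> i; exact: colors_alt.
- move=> x y z xy yz xz nx ny nz.
  have [||||||w [s1 s2 s3]] := center_exists X_T2 X_connected X_lc branch_between
    (x := val x) (y := val y) (z := val z) X_compact.
  + by move=> /(branch_separates x y z).
  + by move=> /(branch_separates y x z).
  + by move=> /(branch_separates z x y).
  + exact: vI.
  + exact: vI.
  + exact: vI.
  by exists (toT (Br_separates s1 s2 s3)); split; apply/branch_separates.
Qed.

Section Extension.
Variables (Gamma : set (colors n -> colors n)).
Variables (phi psi : T -> T) (gamma delta : T -> colors n -> colors n).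
Hypothesis ca : colored_auto branch_color Gamma phi psi gamma delta.

(** The graph of the extension of [phi] to all of [X]: [q] is located by the colors it must have at
    the images of the branch points. *)
Definition matches (p q : X) := forall x : T,
  (p = val x <-> q = val (phi x)) /\
  (p <> val x -> col (val (phi x)) q = gamma x (col (val x) p)).

Let gamma_inj x : injective (gamma x).
Proof. by have [_ _ gK _] := cauto_act ca x; exact: can_inj gK. Qed.

Lemma matches_uniq p q q' : matches p q -> matches p q' -> q = q'.
Proof.
move=> pq pq'; apply: contrapT => /branch_between[z Bz [qz qz' ne]].
have [e1 h1] := pq (psi (toT Bz)); have [_ h2] := pq' (psi (toT Bz)).
rewrite (cauto_VK ca) /= in e1 h1 h2; apply: ne; apply/(color_of_eqP cc) => //.
have np : p <> val (psi (toT Bz)) by move=> /e1.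
by rewrite h1 // h2.
Qed.

Lemma nbhs_comp_seq p (s : seq T) : (forall x, x \in s -> p <> val x) ->
  nbhs p [set u | forall x, x \in s -> comp (val x) p u].
Proof.
elim: s => [|x s IHs] ps; first by apply: filterS filterT.
have nx : nbhs p (comp (val x) p).
  apply: open_nbhs_nbhs; split; first exact: (comp_open X_T2 X_lc).
  by apply: comp_refl; apply: ps; rewrite mem_head.
have {}/IHs ns : forall y, y \in s -> p <> val y.
  by move=> y ys; apply: ps; rewrite inE ys orbT.
apply: filterS (filterI nx ns) => u [xu su] y.
by rewrite inE => /orP[/eqP->//|]; exact: su.
Qed.

(** For [p] outside [Br X], each branch point confines the image to a closed set [F x]. Finitely
    many of these meet, at the image of a branch point close to [p]; compactness gives a common
    point. *)
Lemma matches_ex p : exists q, matches p q.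
Proof.
have phiI : injective phi := can_inj (cauto_K ca).
have [[a pa]|np] := pselect (exists a : T, p = val a).
  exists (val (phi a)) => x; rewrite pa; split.
    by split=> /val_inj; [move=> ->|move=> /phiI ->].
  by move=> ax; apply: (cauto_color ca) => xa; apply: ax; rewrite xa.
have np' (x : T) : p <> val x by move=> e; apply: np; exists x.
pose F (x : T) := val (phi x) |`
  color_inv c (val (phi x)) (gamma x (col (val x) p)).
have [x|s|q qF] := compact_fip (f := F) X_compact.
- have [[r _ rE] _] := color_invP cc (gamma x (col (val x) p)) (BrT (phi x)).
  by rewrite /F -rE; exact: (comp_closure_closed X_T2 X_lc).
- have [|b Bb bs] := nbhs_meets X_T2 X_connected X_lc branch_between _
    (nbhs_comp_seq (s := s) (fun x _ => np' x)).
    have [_ [a [b ab]] _ _] := hX.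
    have [->|pa] := pselect (p = a); first by exists b; exact/nesym.
    by exists a; exact/nesym.
  exists (val (phi (toT Bb))) => x xs; right; apply/color_inv_mem => //.
  have xb := bs x xs; have bx : toT Bb <> x.
    by move=> e; apply: (comp_neq xb); rewrite -e.
  split; first by move=> /val_inj /phiI.
  have := cauto_color ca (nesym bx); rewrite /branch_color => ->.
  by rewrite /color_of /= -(comp_eq xb).
(* If [q] were the image of [x], a branch point separating [x] from [p] would see both in the same
   color. *)
- have qphi (x : T) : q <> val (phi x).
    move=> qx; have [z Bz zxp] := branch_between (nesym (np' x)).
    have [xz pz ne] := zxp.
    have zx : toT Bz <> x by move=> e; apply: xz; rewrite -e.
    case: (qF (toT Bz)); rewrite qx; first by move=> /val_inj/phiI e; exact: zx.
    move=> /(color_inv_mem cc _ _ (BrT _))[_].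
    have := cauto_color ca zx; rewrite /branch_color => -> /gamma_inj.
    by move=> /(color_of_eqP cc Bz xz pz).
  exists q => x; split; first by split=> [/np'|/qphi].
  by move=> _; case: (qF x) => [/qphi//|/(color_inv_mem cc _ _ (BrT _))[]].
Qed.

(** By compactness it suffices that [g p] is the only cluster point of [g] at [p]. Another one would
    be separated from [g p] by a branch point [z], yet a whole component around [p] is mapped into
    [comp z (g p)]. *)
Lemma matches_continuous (g : X -> X) : (forall p, matches p (g p)) -> continuous g.
Proof.
move=> gm p.
have cl q : cluster (g @ p) q -> q = g p.
  move=> qcl; apply: contrapT => /nesym/branch_between[z Bz [gz qz ne]].
  have [e1 h1] := gm p (psi (toT Bz)); rewrite (cauto_VK ca) /= in e1 h1.
  have px : p <> val (psi (toT Bz)) by move=> /e1.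
  have near_gp : (g @ p) (comp z (g p)).
    have : nbhs p (comp (val (psi (toT Bz))) p).
      by apply: open_nbhs_nbhs; split; [exact: (comp_open X_T2 X_lc)|exact: comp_refl].
    apply: filterS => r pr /=; have rx := comp_neq pr.
    have [e2 h2] := gm r (psi (toT Bz)); rewrite (cauto_VK ca) /= in e2 h2.
    have gr : g r <> z by move=> /e2.
    apply/comp_eqP => //; apply/(color_of_eqP cc) => //.
    by rewrite h1 // h2 // /color_of (comp_eq pr).
  have nq : nbhs q (comp z q).
    by apply: open_nbhs_nbhs; split; [exact: (comp_open X_T2 X_lc)|exact: comp_refl].
  have [r [gr qr]] := qcl _ _ near_gp nq.
  by apply: ne; rewrite (comp_eq gr) (comp_eq qr).
apply: (compact_cluster_set1 X_T2 X_compact); [exact: filterT|exact: filterT|].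
apply/seteqP; split=> [q /cl//|_ ->].
have [|q [_ qcl]] := @X_compact _ (fmap_proper_filter g (nbhs_pfilter p)).
  exact: filterT.
by rewrite -(cl _ qcl).
Qed.

End Extension.

Lemma colored_auto_inv Gamma phi psi gamma delta :
  colored_auto branch_color Gamma phi psi gamma delta ->
  colored_auto branch_color Gamma psi phi (delta \o psi) (gamma \o psi).
Proof.
move=> ca; split; [exact: cauto_VK ca|exact: cauto_K ca| |].
  by move=> x /=; have [? ? ? ?] := cauto_act ca (psi x).
move=> x y xy; have [_ _ gK _] := cauto_act ca (psi x).
have := cauto_color ca (x := psi x) (y := psi y).
rewrite !(cauto_VK ca) /= => -> //.
by move=> /(can_inj (cauto_VK ca)).
Qed.

Lemma matches_inv Gamma phi psi gamma delta p q :
  colored_auto branch_color Gamma phi psi gamma delta ->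
  matches phi gamma p q -> matches psi (delta \o psi) q p.
Proof.
move=> ca pq y; have [e h] := pq (psi y); rewrite (cauto_VK ca) in e h.
split; first by split=> /e.
move=> qy; have [_ _ gK _] := cauto_act ca (psi y).
by rewrite h /= ?gK // => /e.
Qed.

Lemma colored_auto_extends (Gamma : set (colors n -> colors n)) phi psi gamma delta :
  colored_auto branch_color Gamma phi psi gamma delta ->
  induced_permutations (Br X) (kaleidoscopic_group c Gamma) phi.
Proof.
move=> ca; have ca' := colored_auto_inv ca.
have /choice[g gm] := matches_ex ca; have /choice[g' gm'] := matches_ex ca'.
have gK : cancel g g'.
  by move=> p; apply: (matches_uniq ca' (gm' (g p))); exact: matches_inv ca (gm p).
have gK' : cancel g' g.
  move=> q; apply: (matches_uniq ca (gm (g' q))).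
  have := matches_inv ca' (gm' q).
  rewrite (_ : _ \o _ = gamma) //; apply/funext => x /=.
  by rewrite (cauto_K ca).
have gphi a : g (val a) = val (phi a) by apply/(gm (val a) a).1.
have hg : Homeo X g.
  split; first exact: matches_continuous ca _ gm.
  by exists g'; split=> //; exact: matches_continuous ca' _ gm'.
exists g => //; split=> // x Bx.
(* Every color at [x] is the color of some point, so matching colors determines the local action. *)
rewrite (_ : sigma c g x = gamma (toT Bx)); first by have [] := cauto_act ca (toT Bx).
apply/funext => i; have [y yx <-] := color_ex cc i Bx.
rewrite sigma_color //; have [_] := gm y (toT Bx) => <- //.
by rewrite -gphi.
Qed.

End Kaleidoscope.

(** * The two implications *)

Theorem theorem1p4 (R : realType) (n : option nat) (hn : at_least3 n)
    (X : topologicalType) (hX : wazewski_dendrite R X n)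
    (c : X -> set X -> colors n) (hc : kaleidoscopic R c)
    (Gamma : set (colors n -> colors n)) (hGamma : permutation_group Gamma) :
  oligomorphic (induced_permutations (Br X) (kaleidoscopic_group c Gamma))
  <-> oligomorphic Gamma.
Proof.
have kT := branch_colored_pretree hn hX hc; have [cc _] := hc.
have Gcomp := induced_comp cc hGamma.
split=> [oK k|oG k]; last first.
  have cT : countable [set: set_type (Br X)].
    have [dX _ _ _] := hX; have /countable_injP[f fI] := Br_countable dX.
    apply/countable_injP; exists (f \o val) => a b _ _ /= /fI e.
    by apply/val_inj/e; rewrite inE; exact: set_valP.
  have [I [inv invP]] := colored_auto_invariant kT hGamma k cT oG.
  apply: (finite_range_invariant (inv := inv)) => t t' tt'.
  have half (u u' : k.-tuple (set_type (Br X))) : inv u = inv u' ->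
      diagonal_orbit (induced_permutations (Br X) (kaleidoscopic_group c Gamma)) u'
      `<=` diagonal_orbit (induced_permutations (Br X) (kaleidoscopic_group c Gamma)) u.
    move=> /invP[phi [psi [gamma [delta [ca e]]]]].
    by apply: (diagonal_orbit_sub Gcomp _ e); exact: (colored_auto_extends hn hX hc ca).
  by apply/seteqP; split; apply: half.
have [x0] : exists x0 : set_type (Br X), True.
  have [_ [a [b ab]] _ br] := hX; have [z [_ Bz]] := br a b ab.
  by exists (SigSub (mem_set Bz)).
move=> _; have /choice[y yP] i : exists y, y <> x0 /\ branch_color c x0 y = i.
  by have [y ? ?] := color_full kT x0 i; exists y.
(* Prepending [x0] makes every group element relating two lifts fix [x0], so its local action there
   is an element of [Gamma] relating the color tuples. *)
pose lift (t : k.-tuple (colors n)) := [tuple of x0 :: map_tuple y t].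
have [N [code codeP]] := finite_code (oK k.+1).
pose inv t := code (diagonal_orbit
  (induced_permutations (Br X) (kaleidoscopic_group c Gamma)) (lift t)).
apply: (finite_range_invariant (inv := inv)) => t t' tt'.
have half u u' : inv u = inv u' -> diagonal_orbit Gamma u' `<=` diagonal_orbit Gamma u.
  move=> /codeP e; have {e} : diagonal_orbit
      (induced_permutations (Br X) (kaleidoscopic_group c Gamma)) (lift u) (lift u').
    rewrite e; try exact: imageP.
    exists id; first exact: induced_id.
    by apply/val_inj; rewrite /= map_id.
  move=> [h [g [gH gG] gE] /(congr1 val) /= [hx0 hu]].
  have gx0 : g (val x0) = val x0 by rewrite -gE hx0.
  have [_ _ Gc _] := hGamma.
  apply: (diagonal_orbit_sub (a := sigma c g (val x0)) Gc).
    by apply: gG; exact: set_valP.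
  apply: eq_from_tnth => i; rewrite tnth_map.
  have hi : h (y (tnth u i)) = y (tnth u' i).
    have /(congr1 (fun t => tnth t i)) : map_tuple h (map_tuple y u) = map_tuple y u'.
      exact: val_inj.
    by rewrite !tnth_map.
  have [ne e] := yP (tnth u i); have [_ e'] := yP (tnth u' i).
  rewrite -{}e -{}e' /branch_color sigma_color //; last 2 first.
  - exact: set_valP.
  - by move=> /val_inj.
  by rewrite gx0 -gE hi.
by apply/seteqP; split; apply: half.
Qed.
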